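(* Let $C$ be the group with generators $u_1,\dots,u_{27}$ and relations (R1)–(R4) below, and let $\psi_C\colon C\to S_{18}$ be the homomorphism sending $u_j$ to the transposition $(\alpha\,\beta)$, where $\{\alpha,\beta\}$ is the pair of endpoints of edge $j$ of $T$. Then: (i) $\psi_C$ is surjective. The subgroup $\langle u_j : j\in T_0\rangle$, where $T_0=\{5,6,8,9,11,12,14,16,18,19,20,21,22,24,25,26,27\}$ is a spanning tree of $T$, is mapped isomorphically onto $S_{18}$ by $\psi_C$. Hence $C=S_{18}\ltimes K_C$ with $K_C=\ker\psi_C$. (ii) Let $H$ be the group generated by $x_1,\dots,x_{18},y_1,\dots,y_{18},z$ with relations $[x_i,x_j]=[y_i,y_j]=[x_i,y_j]=1$ for all $i\neq j$, $[x_i,y_i]=z$ for all $i$, and $z$ central. Let $\mathrm{ab}\colon H\to\mathbb{Z}^2=\langle x\rangle\times\langle y\rangle$ be given by $x_i\mapsto x$, $y_i\mapsto y$, $z\mapsto 1$. Then $K_C\cong\ker(\mathrm{ab})$. Moreover $C\cong S_{18}\ltimes\ker(\mathrm{ab})$, where $\sigma\in S_{18}$ acts by $x_i\mapsto x_{\sigma(i)}$, $y_i\mapsto y_{\sigma(i)}$, $z\mapsto z$, and under this isomorphism $\psi_C$ corresponds to the projection onto $S_{18}$. (iii) In particular, $K_C$ is a central extension of $\mathbb{Z}^{34}$ by $\mathbb{Z}=\langle z\rangle$, and the center of $C$ is the infinite cyclic group $\langle z\rangle$.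
   Context: Let $T$ be the graph with vertex set $\{1,\dots,18\}$ and 27 edges labelled $1,\dots,27$. Edge $j$ joins the two vertices listed after it: 1:$\{2,7\}$, 2:$\{1,13\}$, 3:$\{4,9\}$, 4:$\{1,3\}$, 5:$\{1,5\}$, 6:$\{2,3\}$, 7:$\{2,6\}$, 8:$\{3,10\}$, 9:$\{4,6\}$, 10:$\{4,5\}$, 11:$\{5,8\}$, 12:$\{6,14\}$, 13:$\{7,15\}$, 14:$\{7,11\}$, 15:$\{8,12\}$, 16:$\{8,16\}$, 17:$\{9,11\}$, 18:$\{9,17\}$, 19:$\{10,12\}$, 20:$\{10,18\}$, 21:$\{11,12\}$, 22:$\{13,15\}$, 23:$\{13,17\}$, 24:$\{14,18\}$, 25:$\{14,16\}$, 26:$\{15,16\}$, 27:$\{17,18\}$. (Geometrically, the vertices of $T$ are the 18 planes and the edges are the 27 intersection lines of a degeneration of $\mathbb{T}\times\mathbb{T}$, for $\mathbb{T}$ a complex torus, into a union of planes. This triangulates a torus with 9 vertices $V_1,\dots,V_9$, each lying on 6 lines.) Nine hexagons in $T$ are given by ordered 6-tuples of edges $(a_r,b_r,c_r,d_r,e_r,f_r)$, $r=1,\dots,9$: $V_1$: $(2,4,6,1,13,22)$; $V_2$: $(1,7,9,3,17,14)$; $V_3$: $(3,10,5,2,23,18)$; $V_4$: $(11,15,19,8,4,5)$; $V_5$: $(8,20,24,12,7,6)$; $V_6$: $(12,25,16,11,10,9)$; $V_7$: $(26,13,14,21,15,16)$; $V_8$: $(21,17,18,27,20,19)$; $V_9$: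 $(27,23,22,26,25,24)$. In each tuple, cyclically consecutive edges share an endpoint, so the six edges form a 6-cycle in $T$. The group $C$ is generated by $u_1,\dots,u_{27}$ with the relations: (R1) $u_j^2=1$ for all $j$; (R2) $u_iu_j=u_ju_i$ whenever edges $i$ and $j$ have no common endpoint; (R3) $u_iu_ju_i=u_ju_iu_j$ whenever $i\neq j$ and edges $i,j$ share an endpoint; (R4) for each $r=1,\dots,9$: $u_{a_r}u_{b_r}u_{c_r}u_{d_r}u_{e_r}=u_{b_r}u_{c_r}u_{d_r}u_{e_r}u_{f_r}$. *)

(* Defs.v *)
(* Abstract (possibly infinite) groups are given by an
   explicit record with the group axioms; finitely presented groups are
   characterised by their universal property. *)
From mathcomp Require Import all_boot all_order all_algebra all_fingroup.
Set Implicit Arguments. Unset Strict Implicit. Unset Printing Implicit Defensive.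

Record agroup := AGroup {
  gcar :> Type;
  gmul : gcar -> gcar -> gcar;
  gone : gcar;
  ginv : gcar -> gcar;
  gmulA : forall a b c, gmul a (gmul b c) = gmul (gmul a b) c;
  gmul1 : forall a, gmul gone a = a;
  gmulV : forall a, gmul (ginv a) a = gone }.

Arguments gmul {_}. Arguments gone {_}. Arguments ginv {_}.
Notation "a ** b" := (gmul a b) (at level 40, left associativity).

Definition ghom (G G' : agroup) (f : G -> G') : Prop :=
  forall a b : G, f (a ** b) = f a ** f b.

Definition gker (G G' : agroup) (f : G -> G') : G -> Prop := fun a => f a = gone.

Definition gcomm (G : agroup) (a b : G) : G := ginv a ** ginv b ** a ** b.

Fixpoint gpown (G : agroup) (a : G) (n : nat) : G :=
  match n with O => gone | S n => gpown a n ** a end.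
Definition gpow (G : agroup) (a : G) (n : int) : G :=
  match n with Posz m => gpown a m | Negz m => ginv (gpown a m.+1) end.

Inductive gen_sub (G : agroup) (S : G -> Prop) : G -> Prop :=
| gen_one : gen_sub S gone
| gen_in  : forall a, S a -> gen_sub S a
| gen_mul : forall a b, gen_sub S a -> gen_sub S b -> gen_sub S (a ** b)
| gen_inv : forall a, gen_sub S a -> gen_sub S (ginv a).

Definition central (G : agroup) (a : G) : Prop := forall b : G, a ** b = b ** a.

Definition iso_on (G G' : agroup) (f : G -> G') (A : G -> Prop) (B : G' -> Prop) : Prop :=
  [/\ (forall a b, A a -> A b -> f (a ** b) = f a ** f b),
      (forall a, A a -> B (f a)),
      (forall a b, A a -> A b -> f a = f b -> a = b) &
      (forall b, B b -> exists a, A a /\ f a = b)].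

Definition PermGroup : agroup :=
  @AGroup {perm 'I_18} (fun s t => (s * t)%g) 1%g (fun s => s^-1)%g
    (@mulgA _) (@mul1g _) (@mulVg _).

Definition ZmodGroup (V : zmodType) : agroup :=
  @AGroup V (fun a b => (a + b)%R) 0%R (fun a => (- a)%R)
    (@GRing.addrA V) (@GRing.add0r V) (@GRing.addNr V).

Definition Z2 : agroup := ZmodGroup 'rV[int]_2.
Definition Z34 : agroup := ZmodGroup 'rV[int]_34.
Definition xZ : 'rV[int]_2 := delta_mx ord0 ord0.
Definition yZ : 'rV[int]_2 := delta_mx ord0 (inord 1).

(* edge j (1-based) joins the two (1-based) vertices listed *)
Definition edges : seq (nat * nat) :=
  [:: (2,7); (1,13); (4,9); (1,3); (1,5); (2,3); (2,6); (3,10); (4,6);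
      (4,5); (5,8); (6,14); (7,15); (7,11); (8,12); (8,16); (9,11); (9,17);
      (10,12); (10,18); (11,12); (13,15); (13,17); (14,18); (14,16);
      (15,16); (17,18)].

(* vertex v (1-based) as an element of 'I_18 (i.e. vertex v is v-1) *)
Definition vtx (v : nat) : 'I_18 := inord v.-1.
(* edge k (1-based) as an element of 'I_27 *)
Definition edg (k : nat) : 'I_27 := inord k.-1.

Definition ep1 (j : 'I_27) : 'I_18 := vtx (nth (0,0) edges j).1.
Definition ep2 (j : 'I_27) : 'I_18 := vtx (nth (0,0) edges j).2.

Definition share (i j : 'I_27) : bool :=
  [|| ep1 i == ep1 j, ep1 i == ep2 j, ep2 i == ep1 j | ep2 i == ep2 j].

(* the nine hexagons (a,b,c,d,e,f), edge labels 1-based *)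
Definition hexagons : seq (seq nat) :=
  [:: [:: 2;4;6;1;13;22]; [:: 1;7;9;3;17;14]; [:: 3;10;5;2;23;18];
      [:: 11;15;19;8;4;5]; [:: 8;20;24;12;7;6]; [:: 12;25;16;11;10;9];
      [:: 26;13;14;21;15;16]; [:: 21;17;18;27;20;19]; [:: 27;23;22;26;25;24]].

Definition T0 : seq 'I_27 :=
  map edg [:: 5;6;8;9;11;12;14;16;18;19;20;21;22;24;25;26;27].

Definition hex_rel (G : agroup) (g : 'I_27 -> G) (h : seq nat) : Prop :=
  let U k := g (edg (nth 0 h k)) in
  U 0 ** U 1 ** U 2 ** U 3 ** U 4 = U 1 ** U 2 ** U 3 ** U 4 ** U 5.

Definition CRel (G : agroup) (g : 'I_27 -> G) : Prop :=
  [/\ (forall j, g j ** g j = gone),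
      (forall i j, ~~ share i j -> g i ** g j = g j ** g i),
      (forall i j, i != j -> share i j ->
                   g i ** g j ** g i = g j ** g i ** g j) &
      (forall h, h \in hexagons -> hex_rel g h)].

Definition presentsC (C : agroup) (u : 'I_27 -> C) : Prop :=
  CRel u /\
  forall (G : agroup) (g : 'I_27 -> G), CRel g ->
    exists! f : C -> G, ghom f /\ forall j, f (u j) = g j.

Definition HRel (G : agroup) (x y : 'I_18 -> G) (z : G) : Prop :=
  [/\ (forall i j, i != j ->
         [/\ gcomm (x i) (x j) = gone, gcomm (y i) (y j) = gone &
             gcomm (x i) (y j) = gone]),
      (forall i, gcomm (x i) (y i) = z) &
      central z].

Definition presentsH (H : agroup) (x y : 'I_18 -> H) (z : H) : Prop :=
  HRel x y z /\
  forall (G : agroup) (x' y' : 'I_18 -> G) (z' : G), HRel x' y' z' ->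
    exists! f : H -> G,
      [/\ ghom f, (forall i, f (x i) = x' i), (forall i, f (y i) = y' i) & f z = z'].

(* Main.v *)
Require Import Defs.
From HB Require Import structures.
From mathcomp Require Import all_boot all_order all_algebra all_fingroup.
From mathcomp Require Import ring zify.
From mathcomp Require boolp.

(* Put [M] for the semidirect product of [S_18] with the Heisenberg group [H].
   Over a transposition [(p q)], the involutions of [M] are the reflections
   [refl p q w] with [w] in [Z^2], and conjugation by an element of [H] adds to
   each [w] the difference at [p] and [q] of a potential on the vertices.
   Reflections along the edges of [T] thus satisfy (R1)-(R4) as soon as their
   displacements [w] sum to zero around every hexagon: the displacements in the
   universal cover of the torus define a morphism from [C] to [M], whose image
   is the subgroup of balanced elements, [S_18] times the kernel of [ab].

   Conversely, let [u] satisfy the relations in a group [G]. The generators of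
   a Hamiltonian path of [T] satisfy the Coxeter relations, hence extend to a
   morphism on [S_18]. Multiplying [u 13] and [u 8] by their transpositions and
   conjugating by [S_18] gives two families of translations [X p q], [Y p q],
   and the hexagons express all other generators through them. The two values
   that [u 15] receives from two hexagons force [X q p * X r s] and [Y q r] to
   commute, whence all the commutators of [X p q] and [Y p r] coincide and are
   central. These are the relations of the balanced subgroup, so there is a
   morphism from it to [G] sending the reflections back to [u]. *)

Set Implicit Arguments. Unset Strict Implicit. Unset Printing Implicit Defensive.
Import GroupScope GRing.Theory Num.Theory.

(** * Groups *)

Section AgroupGroup.
Variable G : agroup.

Lemma agroup_mulgV (a : G) : a ** ginv a = gone.
Proof.
rewrite -[LHS]gmul1 -[X in X ** _](gmulV (ginv a)) gmulA -(gmulA _ _ a).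
by rewrite gmulV -gmulA gmul1 gmulV.
Qed.

Lemma agroup_mulg1 (a : G) : a ** gone = a.
Proof. by rewrite -(gmulV a) gmulA agroup_mulgV gmul1. Qed.

(* A [groupType] carries a choice structure, which an arbitrary carrier only
   has classically. *)
HB.instance Definition _ := boolp.gen_eqMixin G.
HB.instance Definition _ := boolp.gen_choiceMixin G.
HB.instance Definition _ := isGroup.Build G
  (@gmulA G) (@gmul1 G) agroup_mulg1 (@gmulV G) agroup_mulgV.

Lemma gcommE (a b : G) : gcomm a b = [~ a, b].
Proof. by rewrite /gcomm /commg /conjg !mulgA. Qed.

End AgroupGroup.

Definition agroup_of (G : groupType) : agroup :=
  AGroup (@mulgA G) (@mul1g G) (@mulVg G).

Notation "{ 'gmorphism' G -> K }" := (UMagmaMorphism.type G K)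
  (at level 0, G at level 98, K at level 99, format "{ 'gmorphism'  G  ->  K }").

Lemma morphM_morph1 (G K : groupType) (f : G -> K) :
  {morph f : x y / x * y} -> f 1 = 1.
Proof. by move=> fM; apply: (mulgI (f 1)); rewrite -fM !mulg1. Qed.

Definition gmorphism_of (G K : groupType) (f : G -> K)
    (fM : {morph f : x y / x * y}) : {gmorphism G -> K} :=
  HB.pack_for {gmorphism G -> K} f
    (isUMagmaMorphism.Build G K f (morphM_morph1 fM, fM)).

Section GroupTheory.
Variable G : groupType.
Implicit Types a b c : G.

Lemma commute_conjgP a b : commute a b <-> a ^ b = a.
Proof. by split=> [/commgP/conjg_fixP|/conjg_fixP/commgP]. Qed.

Lemma commute_conj a b c : commute a b -> commute (a ^ c) (b ^ c).
Proof. by rewrite /commute -!conjMg => ->. Qed.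

Lemma commute_commg a b c : commute c a -> commute c b -> commute c [~ a, b].
Proof. by move=> ca cb; do !apply: commuteM => //; apply: commuteV. Qed.

Lemma commMg_commute a b c : commute a c -> [~ a * b, c] = [~ b, c].
Proof.
by move=> /commute_conjgP ac; rewrite !commgEl conjMg ac invgM -mulgA mulKg.
Qed.

Lemma commgM_commute a b c : commute a b -> [~ a, b * c] = [~ a, c].
Proof. by move=> /commute_conjgP ab; rewrite !commgEl conjgM ab. Qed.

Lemma conjg_commg a b : a ^ b = a * [~ a, b].
Proof. by rewrite commgEl mulVKg. Qed.

Lemma conjg_swap a b c : a ^ b = a * c -> b ^ a = b * c^-1.
Proof. by move=> ab; apply: (mulgI a); rewrite -conjgC mulgA (conjgC a b) ab mulgA mulgK. Qed.

Lemma mulgA_conjg a b a' b' : a * b * (a' * b') = a * a' * (b ^ a' * b').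
Proof. by rewrite conjgE !mulgA mulgK. Qed.

Lemma conjg_involution a b : b * b = 1 -> a ^ b = b * a * b.
Proof. by move=> bb; rewrite conjgE (mulg1_eq bb) mulgA. Qed.

Lemma conjgV_involution a b : a * a = 1 -> a ^ b = a * (b^-1 ^ a * b).
Proof. by move=> aa; rewrite (conjg_involution b^-1) // !mulgA aa mul1g conjgE mulgA. Qed.

End GroupTheory.

(** * Integer powers *)

Definition expgz (G : groupType) (x : G) (m : int) : G :=
  match m with Posz k => x ^+ k | Negz k => x ^- k.+1 end.

Section IntegerPowers.
Variable G : groupType.
Implicit Types x y : G.

Lemma commute_expgz x y m : commute x y -> commute x (expgz y m).
Proof. by move=> xy; case: m => k; [|apply: commuteV]; apply: commuteX. Qed.

Lemma expgzSr x m : expgz x (m + 1)%R = expgz x m * x.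
Proof.
case: m => [k|[|k]]; first by rewrite -PoszD addn1 -expgSr.
  by rewrite /= expg1 mulVg.
rewrite (_ : (Negz k.+1 + 1)%R = Negz k) /=; last by lia.
by rewrite [x ^+ k.+2]expgS invgM mulgVK.
Qed.

Lemma expgzBr x m : expgz x (m - 1)%R = expgz x m * x^-1.
Proof. by apply: (mulIg x); rewrite -expgzSr subrK mulgVK. Qed.

Lemma expgzD x : {morph expgz x : m k / (m + k)%R >-> m * k}.
Proof.
move=> m k; elim: k => [|k IH|k IH]; first by rewrite addr0 mulg1.
  by rewrite -addn1 PoszD addrA !expgzSr IH mulgA.
by rewrite -addn1 PoszD opprD addrA !expgzBr IH mulgA.
Qed.

Lemma gpowE (H : agroup) (x : H) m : gpow x m = expgz x m.
Proof.
have gpownE k : gpown x k = x ^+ k by elim: k => //= k ->; rewrite expgSr.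
by case: m => k; rewrite /gpow gpownE.
Qed.

Lemma gmulf_expgz (K : groupType) (f : {gmorphism G -> K}) m :
  {morph f : x / expgz x m}.
Proof. by case: m => k x; rewrite /= (gmulfV, gmulfXn) ?gmulfXn. Qed.

End IntegerPowers.

Section ExponentialMaps.
Variables (V : zmodType) (G : groupType) (f : V -> G).
Hypothesis fD : {morph f : v w / (v + w)%R >-> v * w}.

Lemma expmap0 : f 0%R = 1.
Proof. by apply: (mulgI (f 0%R)); rewrite -fD addr0 mulg1. Qed.

Lemma expmapN v : f (- v)%R = (f v)^-1.
Proof. by apply/esym/mulg1_eq; rewrite -fD subrr expmap0. Qed.

Lemma expmapMz v m : f (v *~ m)%R = expgz (f v) m.
Proof.
elim: m => [|m IH|m IH]; first by rewrite mulr0z expmap0.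
  by rewrite -addn1 PoszD mulrzDr fD IH expgzSr.
by rewrite -addn1 PoszD opprD mulrzDr fD IH mulrNz expmapN expgzBr.
Qed.

End ExponentialMaps.

Lemma expmap_row_ext (G : groupType) n (f g : 'rV[int]_n -> G) :
  {morph f : v w / (v + w)%R >-> v * w} -> {morph g : v w / (v + w)%R >-> v * w} ->
  (forall i, f (delta_mx 0 i)%R = g (delta_mx 0 i)%R) -> f =1 g.
Proof.
move=> fD gD fg v; rewrite (row_sum_delta v).
elim/big_ind: _ => [|w w' e e'|i _]; first by rewrite !expmap0.
  by rewrite fD gD e e'.
by rewrite -[v 0%R i]intz scaler_int !expmapMz ?fg.
Qed.

Section PowerProducts.
Variables (G : groupType) (n : nat).
Implicit Types (X : 'I_n -> G) (a : 'rV[int]_n).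

Definition prodgz X a : G := \prod_i expgz (X i) (a 0%R i).

Lemma commute_prodgz X a y : (forall i, commute y (X i)) -> commute y (prodgz X a).
Proof. by move=> yX; apply: commute_prod => i _; apply: commute_expgz. Qed.

Lemma prodgzD X : (forall i j, commute (X i) (X j)) ->
  {morph prodgz X : a b / (a + b)%R >-> a * b}.
Proof.
move=> XX a b; rewrite -prodgM_commute => [|i j _ _].
  by apply: eq_bigr => i _; rewrite mxE expgzD.
by apply/commute_expgz/commute_sym/commute_expgz.
Qed.

Lemma prodgz0 X : prodgz X 0%R = 1.
Proof. by apply: big1 => i _; rewrite mxE. Qed.

Lemma prodgz_delta X i : prodgz X (delta_mx 0 i)%R = X i.
Proof.
rewrite -[RHS](big_pred1_eq *%g i X) big_mkcond; apply: eq_bigr => j _.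
by rewrite mxE eqxx; case: eqP => //.
Qed.

End PowerProducts.

Lemma gmulf_prodgz (G K : groupType) (f : {gmorphism G -> K}) n (X : 'I_n -> G) a :
  f (prodgz X a) = prodgz (f \o X) a.
Proof. by rewrite gmulf_prod; apply: eq_bigr => i _; rewrite gmulf_expgz. Qed.

(** * Heisenberg normal forms *)

Section BilinearForm.
Local Open Scope ring_scope.
Variables (R : pzRingType) (n : nat) (B : 'M[R]_n).
Implicit Types a b : 'rV[R]_n.

Definition bform a b : R := (a *m B *m b^T) 0 0.

Lemma bformDl b : {morph bform^~ b : a a' / a + a'}.
Proof. by move=> a a'; rewrite /bform !mulmxDl mxE. Qed.

Lemma bformDr a : {morph bform a : b b' / b + b'}.
Proof. by move=> b b'; rewrite /bform linearD mulmxDr mxE. Qed.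

Lemma bform_delta i j : bform (delta_mx 0 i) (delta_mx 0 j) = B i j.
Proof. by rewrite /bform -rowE trmx_delta -colE !mxE. Qed.

End BilinearForm.

Section Rows.
Local Open Scope ring_scope.
Variables (R : pzRingType) (n : nat).

Definition row_x (v : 'M[R]_(2, n)) : 'rV[R]_n := row 0 v.
Definition row_y (v : 'M[R]_(2, n)) : 'rV[R]_n := row 1 v.

Lemma row_xD : {morph row_x : v w / v + w}. Proof. exact: linearD. Qed.
Lemma row_yD : {morph row_y : v w / v + w}. Proof. exact: linearD. Qed.

End Rows.

Section HeisenbergNormalForm.
Local Open Scope ring_scope.
Variables (G : groupType) (n : nat) (X Y : 'I_n -> G) (z : G) (B : 'M[int]_n).
Hypothesis XX : forall i j, commute (X i) (X j).
Hypothesis YY : forall i j, commute (Y i) (Y j).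
Hypothesis zX : forall i, commute z (X i).
Hypothesis zY : forall i, commute z (Y i).
Hypothesis XY : forall i j, (X i ^ Y j = X i * expgz z (B i j))%g.

Lemma commute_prodgz_expgz (W : 'I_n -> G) a m :
  (forall i, commute z (W i)) -> commute (expgz z m) (prodgz W a).
Proof. by move=> zW; apply/commute_sym/commute_expgz/commute_sym/commute_prodgz. Qed.

Lemma prodgz_conj (W : 'I_n -> G) (g : G) (l : 'rV[int]_n -> int) :
  (forall i j, commute (W i) (W j)) -> (forall i, commute z (W i)) ->
  {morph l : a b / a + b} ->
  (forall i, (W i ^ g = W i * expgz z (l (delta_mx 0 i)))%g) ->
  forall a, (prodgz W a ^ g = prodgz W a * expgz z (l a))%g.
Proof.
move=> WW zW lD Wg; apply: expmap_row_ext => [a b|a b|i].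
- by rewrite prodgzD // conjMg.
- rewrite prodgzD // lD expgzD !mulgA; congr (_ * _)%g; rewrite -!mulgA.
  by congr (_ * _)%g; apply/commute_sym/commute_prodgz_expgz.
- by rewrite prodgz_delta.
Qed.

Lemma prodgz_bform_conj (a b : 'rV[int]_n) :
  (prodgz X a ^ prodgz Y b = prodgz X a * expgz z (bform B a b))%g.
Proof.
move: a; apply: prodgz_conj => // [|i]; first exact: bformDl.
have YX : (prodgz Y b ^ X i = prodgz Y b * expgz z (- bform B (delta_mx 0 i) b))%g.
  apply: (prodgz_conj (l := fun c => - bform B (delta_mx 0 i) c)) => // [c d|j].
    by rewrite bformDr opprD.
  by rewrite bform_delta (expmapN (expgzD z)); apply/conjg_swap/XY.
by rewrite (conjg_swap YX) -(expmapN (expgzD z)) opprK.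
Qed.

Definition heis_nf (v : 'M[int]_(2, n)) (c : int) : G :=
  (prodgz X (row_x v) * prodgz Y (row_y v) * expgz z c)%g.

Lemma heis_nf0 c : heis_nf 0 c = expgz z c.
Proof. by rewrite /heis_nf /row_x /row_y !linear0 !prodgz0 !mul1g. Qed.

Lemma heis_nf_x i : heis_nf (delta_mx 0 i) 0 = X i.
Proof.
rewrite /heis_nf mulg1 (_ : row_x _ = delta_mx 0 i) 1?(_ : row_y _ = 0).
- by rewrite prodgz0 prodgz_delta mulg1.
- by apply/rowP => j; rewrite !mxE.
- by apply/rowP => j; rewrite !mxE.
Qed.

Lemma heis_nf_y i : heis_nf (delta_mx 1 i) 0 = Y i.
Proof.
rewrite /heis_nf mulg1 (_ : row_y _ = delta_mx 0 i) 1?(_ : row_x _ = 0).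
- by rewrite prodgz0 prodgz_delta mul1g.
- by apply/rowP => j; rewrite !mxE.
- by apply/rowP => j; rewrite !mxE.
Qed.

Lemma heis_nfM v c v' c' : (heis_nf v c * heis_nf v' c')%g =
  heis_nf (v + v') (c + c' - bform B (row_x v') (row_y v)).
Proof.
have comm_zY m b := commute_prodgz_expgz b m zY.
have comm_zX m a := commute_prodgz_expgz a m zX.
have YX : (prodgz Y (row_y v) * prodgz X (row_x v') = prodgz X (row_x v') *
    prodgz Y (row_y v) * expgz z (- bform B (row_x v') (row_y v)))%g.
  by rewrite conjgC (conjg_swap (prodgz_bform_conj _ _)) -(expmapN (expgzD z)) mulgA.
rewrite /heis_nf row_xD row_yD !prodgzD // !expgzD -!mulgA; congr (_ * _)%g.
rewrite (mulgA (expgz z c)) comm_zX -!mulgA (mulgA (prodgz Y _)) YX -!mulgA.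
rewrite !(mulgA (expgz z c)) comm_zY -!mulgA; do 2!congr (_ * _)%g.
rewrite (mulgA (expgz z _)) comm_zY -!mulgA; congr (_ * _)%g.
by rewrite -!expgzD addrC addrA.
Qed.

End HeisenbergNormalForm.

Lemma gmulf_heis_nf (G K : groupType) (f : {gmorphism G -> K}) n (X Y : 'I_n -> G) z v c :
  f (heis_nf X Y z v c) = heis_nf (f \o X) (f \o Y) (f z) v c.
Proof. by rewrite /heis_nf !gmulfM !gmulf_prodgz gmulf_expgz. Qed.

Lemma eq_heis_nf (G : groupType) n (X X' Y Y' : 'I_n -> G) z :
  X =1 X' -> Y =1 Y' -> heis_nf X Y z =2 heis_nf X' Y' z.
Proof.
move=> XX' YY' v c; rewrite /heis_nf /prodgz; congr (_ * _ * _).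
  by apply: eq_bigr => i _; rewrite XX'.
by apply: eq_bigr => i _; rewrite YY'.
Qed.

(** * The Coxeter presentation of the symmetric group *)

Definition coxeter_rel (G : groupType) (n : nat) (t : nat -> G) : Prop :=
  [/\ forall i, i < n -> t i * t i = 1,
      forall i j, i.+1 < j < n -> commute (t i) (t j) &
      forall i, i.+1 < n -> t i * t i.+1 * t i = t i.+1 * t i * t i.+1].

Fixpoint descent (G : groupType) (t : nat -> G) (m d : nat) : G :=
  if d is d'.+1 then t (m + d') * descent t m d' else 1.

Section Descent.
Variables (G : groupType) (n : nat) (t : nat -> G).
Hypothesis t_coxeter : coxeter_rel n t.

Lemma descentSr m d : descent t m d.+1 = descent t m.+1 d * t m.
Proof.
elim: d => [|d IH]; first by rewrite /= addn0 mul1g mulg1.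
by rewrite [LHS]/= -/(descent t m d.+1) IH mulgA addnS.
Qed.

Lemma commute_descent_below m d i : i.+1 < m -> m + d <= n ->
  commute (t i) (descent t m d).
Proof.
case: t_coxeter => _ tt _ im; elim: d => [|d IH] md; first exact: commute1.
by apply: commuteM; [apply: tt; lia | apply: IH; lia].
Qed.

Lemma commute_descent_above m d i : m + d < i < n -> commute (t i) (descent t m d).
Proof.
case: t_coxeter => _ tt _; elim: d => [|d IH] mdi; first exact: commute1.
by apply: commuteM; [apply/commute_sym/tt; lia | apply: IH; lia].
Qed.

Lemma descent_shift m d i : m < i < m + d -> m + d <= n ->
  descent t m d * t i = t i.-1 * descent t m d.
Proof.
case: t_coxeter => _ tt braid; elim: d => [|d IH] mi mdn; first lia.
have [im|im] := ltnP i (m + d).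
  rewrite /= -mulgA IH; [|lia..].
  by rewrite !mulgA; congr (_ * _); apply/commute_sym/tt; lia.
have {im} ei : i = m + d by lia.
case: d mi mdn ei {IH} => [|d] mi mdn ei; first lia.
rewrite /= addnS in ei *; rewrite -!mulgA -(@commute_descent_above m d i); last lia.
by rewrite ei !mulgA /= -braid //; lia.
Qed.

End Descent.

Section PermLemmas.
Variable T : finType.
Implicit Types p q r : T.

Lemma commute_tperm p q r (s : T) : p != r -> p != s -> q != r -> q != s ->
  commute (tperm p q) (tperm r s).
Proof.
by move=> pr ps qr qs; apply/commute_conjgP; rewrite tpermJ !tpermD // eq_sym.
Qed.

Lemma tperm_braid p q r : p != q -> q != r -> p != r ->
  tperm p q * tperm q r * tperm p q = tperm p r.
Proof.
move=> pq qr pr; rewrite -conjg_involution ?tperm2 // tpermJ tpermR tpermD //.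
Qed.

Lemma tperm_braid_meet p q r (s : T) : p != q -> r != s ->
  [|| p == r, p == s, q == r | q == s] -> (r \notin [:: p; q]) || (s \notin [:: p; q]) ->
  tperm p q * tperm r s * tperm p q = tperm r s * tperm p q * tperm r s.
Proof.
have braid (a b c : T) : a != b -> b != c -> a != c ->
    tperm a b * tperm b c * tperm a b = tperm b c * tperm a b * tperm b c.
  move=> ab bc ac; rewrite tperm_braid // [tperm b c]tpermC [tperm a b]tpermC.
  by rewrite tperm_braid 1?tpermC // eq_sym.
move=> pq rs /or4P[] /eqP e; rewrite e !inE ?eqxx ?orbT ?orbF ?negb_or /= in pq rs *.
- by case/andP=> sr sq; rewrite (tpermC r q); apply: braid => //; rewrite eq_sym.
- by case/andP=> _ rq; rewrite (tpermC r s) (tpermC s q); apply: braid => //; rewrite eq_sym.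
- by case/andP=> sp _; apply: braid => //; rewrite eq_sym.
- by case/andP=> rp _; rewrite (tpermC r s); apply: braid => //; rewrite eq_sym.
Qed.

Lemma perm_on_ind (A : {set T}) (P : {perm T} -> Prop) : P 1 ->
  (forall s p q, p \in A -> q \in A -> P s -> P (s * tperm p q)) ->
  forall s, perm_on A s -> P s.
Proof.
move=> P1 PM s; have [m] := ubnP #|[set p | s p != p]|.
elim: m s => // m IH s; rewrite ltnS => sm sA.
have [p sp|s1] := pickP [pred p | s p != p]; last first.
  by rewrite (_ : s = 1) //; apply/permP => p; rewrite perm1; apply/eqP/negbFE/s1.
have pA : p \in A by apply: contraNT sp => pA; rewrite (out_perm sA pA).
rewrite -(mulgK (tperm p (s p)) s) tpermV; apply: PM; rewrite ?perm_closed //.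
apply: IH; last first.
  apply: perm_onM => //; apply: subset_trans (tperm_on _ _) _.
  by apply/subsetP => q /set2P[] ->; rewrite ?perm_closed.
apply: leq_trans sm; apply/proper_card/properP; split; last first.
  by exists p; rewrite !inE ?permM ?tpermR ?eqxx.
apply/subsetP => q; rewrite !inE permM; apply: contraNN => /eqP sq.
have qp : q != p by apply: contraNneq sp => <-; rewrite sq.
by rewrite sq tpermD //; rewrite eq_sym // -[q]sq (inj_eq perm_inj).
Qed.

Lemma tperm_trans (P : {perm T} -> Prop) : P 1 ->
  (forall s t, P s -> P t -> P (s * t)) ->
  forall p q r, P (tperm p q) -> P (tperm q r) -> P (tperm p r).
Proof.
move=> P1 PM p q r; have [->//|pq] := eqVneq p q; have [<-//|qr] := eqVneq q r.
have [->|pr] := eqVneq p r; first by rewrite tperm1.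
by move=> Ppq Pqr; rewrite -(tperm_braid pq qr pr); apply: (PM _ _ (PM _ _ Ppq Pqr) Ppq).
Qed.

Lemma perm_map_exists (s t : seq T) : uniq s -> uniq t -> size s = size t ->
  exists f : {perm T}, map f s = t.
Proof.
elim: s t => [|p s IH] [|q t] //=; first by exists 1.
case/andP=> ps us /andP[qt ut] [/(IH _ us ut) [f ft]].
exists (f * tperm (f p) q); rewrite permM tpermL; congr (_ :: _).
rewrite -[RHS]ft; apply/eq_in_map => r rs; rewrite permM tpermD //.
  by rewrite (inj_eq perm_inj); apply: contraNneq ps => ->.
by apply: contraNneq qt => ->; rewrite -ft map_f.
Qed.

End PermLemmas.

Section AdjacentTranspositions.
Variable n : nat.
Implicit Type s : {perm 'I_n.+1}.

Definition adj_tperm (i : nat) : {perm 'I_n.+1} := tperm (inord i) (inord i.+1).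

Lemma inord_eq i j : i <= n -> j <= n -> (inord i == inord j :> 'I_n.+1) = (i == j).
Proof. by move=> hi hj; rewrite -val_eqE /= !inordK. Qed.

Lemma adj_tperm_coxeter : coxeter_rel n adj_tperm.
Proof.
split=> [i _|i j ij|i ii]; first exact: tperm2.
  by apply: commute_tperm; rewrite inord_eq; lia.
rewrite tperm_braid ?inord_eq; try lia.
rewrite /adj_tperm ![tperm (inord i) _]tpermC [tperm (inord i.+1) _]tpermC.
by rewrite tperm_braid ?inord_eq //; lia.
Qed.

Lemma adj_tperm_out i j : i < n -> j <= n -> j != i -> j != i.+1 ->
  adj_tperm i (inord j) = inord j.
Proof. by move=> *; rewrite tpermD ?inord_eq //; lia. Qed.

Lemma descent_adj_out m d j : m + d < j <= n ->
  descent adj_tperm m d (inord j) = inord j.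
Proof.
elim: d => [|d IH] mj; first by rewrite perm1.
by rewrite permM adj_tperm_out ?IH //; lia.
Qed.

Lemma descent_adj_last m d : m + d <= n ->
  descent adj_tperm m d (inord (m + d)) = inord m.
Proof.
elim: d => [|d IH] md; first by rewrite addn0 perm1.
by rewrite permM addnS tpermR IH //; lia.
Qed.

Definition fixes_from (k : nat) s := forall j, k <= j <= n -> s (inord j) = inord j.

Lemma fixes_from_le k s : k <= n -> fixes_from k.+1 s -> s (inord k) <= k.
Proof.
move=> kn sk; rewrite leqNgt; apply/negP => ks.
have : s (inord (s (inord k))) = inord (s (inord k)).
  by apply: sk; rewrite ks -ltnS ltn_ord.
by rewrite inord_val => /perm_inj e; move: ks; rewrite e inordK ?ltnn.
Qed.

Definition last_descent (G : groupType) (t : nat -> G) k s : G :=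
  descent t (s (inord k)) (k - s (inord k)).

Lemma fixes_from_last_descent k s : k <= n -> fixes_from k.+1 s ->
  fixes_from k (s * (last_descent adj_tperm k s)^-1).
Proof.
move=> kn sk j kj; have sle := fixes_from_le kn sk.
rewrite permM; apply: (canLR (permK _)).
have [->|jk] : j = k \/ k < j by lia.
  have := @descent_adj_last (s (inord k)) (k - s (inord k)).
  by rewrite subnKC // inord_val => ->.
by rewrite sk ?descent_adj_out //; lia.
Qed.

Lemma adj_tperm_ind (P : {perm 'I_n.+1} -> Prop) : P 1 ->
  (forall s i, i < n -> P s -> P (s * adj_tperm i)) -> forall s, P s.
Proof.
move=> P1 PM; have Pd s m d : m + d <= n -> P s -> P (s * descent adj_tperm m d).
  elim: d m => [|d IH] m md Ps; first by rewrite mulg1.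
  by rewrite descentSr mulgA; apply: PM; [lia | apply: IH; [lia |]].
suff Pk k s : k <= n.+1 -> fixes_from k s -> P s.
  by move=> s; apply: (Pk n.+1) => // j; lia.
elim: k s => [|k IH] s kn sk.
  rewrite (_ : s = 1) //; apply/permP => j; rewrite perm1.
  by have := sk j; rewrite inord_val leq_ord; apply.
rewrite -(mulgVK (last_descent adj_tperm k s) s); apply: Pd.
  by rewrite subnKC // fixes_from_le.
by apply: IH; [lia | apply: fixes_from_last_descent].
Qed.

End AdjacentTranspositions.

Section CoxeterMorphism.
Variables (G : groupType) (n : nat) (t : nat -> G).
Hypothesis t_coxeter : coxeter_rel n t.
Implicit Type s : {perm 'I_n.+1}.
Local Notation adj := (adj_tperm n).

Fixpoint coxeter_nf k s : G :=
  if k is k'.+1 then coxeter_nf k' (s * (last_descent adj k' s)^-1) * last_descent t k' s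
  else 1.

Lemma coxeter_nf1 k : k <= n.+1 -> coxeter_nf k 1 = 1.
Proof.
elim: k => // k IH kn; rewrite /= /last_descent perm1 inordK // subnn.
by rewrite mulgV IH ?mulg1 // ltnW.
Qed.

Lemma coxeter_nf_adj k s i : k <= n.+1 -> fixes_from k s -> i.+1 < k ->
  coxeter_nf k (s * adj i) = coxeter_nf k s * t i.
Proof.
elim: k s i => // k IH s i; rewrite ltnS => kn sk ik.
have mk := fixes_from_le kn sk; have sk' := fixes_from_last_descent kn sk.
rewrite /= /last_descent permM; rewrite /last_descent in sk'.
set m := s (inord k) in mk sk' *; have em : m = inord m by rewrite inord_val.
have adj_cox := adj_tperm_coxeter n.
have [im|[im|[im|im]]] : i.+1 < m \/ i.+1 = m \/ i = m \/ m < i by lia.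
- rewrite {1 2 3 4}em adj_tperm_out ?inord_val; try lia.
  have adj_comm := commute_descent_below adj_cox im (_ : m + (k - m) <= n).
  have t_comm := commute_descent_below t_coxeter im (_ : m + (k - m) <= n).
  rewrite -mulgA (commuteV (adj_comm _)) ?mulgA ?IH //; try lia.
  by rewrite -!mulgA t_comm //; lia.
- have -> : adj i m = inord i by rewrite em -im /adj_tperm tpermR.
  rewrite inordK; last lia.
  have -> : k - i = (k - m).+1 by lia.
  by rewrite !descentSr im invgM -!mulgA mulVKg mulgA.
- have -> : adj i m = inord i.+1 by rewrite em im /adj_tperm tpermL.
  rewrite inordK; last lia.
  have -> : k - m = (k - i.+1).+1 by lia.
  case: (t_coxeter) => tt _ _; rewrite -im !descentSr invgM tpermV.
  by rewrite -!mulgA tt ?mulg1 //; lia.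
- have -> : adj i m = m by rewrite em adj_tperm_out //; lia.
  have adj_shift := descent_shift adj_cox (_ : m < i < m + (k - m)) (_ : m + (k - m) <= n).
  have t_shift := descent_shift t_coxeter (_ : m < i < m + (k - m)) (_ : m + (k - m) <= n).
  rewrite -(mulgA s).
  have -> : adj i * (descent adj m (k - m))^-1 = (descent adj m (k - m))^-1 * adj i.-1.
    by apply: (mulgI (descent adj m (k - m))); rewrite mulVKg mulgA adj_shift ?mulgK //; lia.
  by rewrite mulgA IH -?mulgA ?t_shift //; lia.
Qed.

Lemma coxeter_morphism : exists f : {gmorphism {perm 'I_n.+1} -> G},
  forall i, i < n -> f (adj i) = t i.
Proof.
have nfS s i : i < n -> coxeter_nf n.+1 (s * adj i) = coxeter_nf n.+1 s * t i.
  by move=> ni; apply: coxeter_nf_adj => // j; lia.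
have nfM : {morph coxeter_nf n.+1 : s s' / s * s'}.
  move=> s s'; elim/adj_tperm_ind: s' => [|s' i ni IH].
    by rewrite coxeter_nf1 // !mulg1.
  by rewrite mulgA !nfS // IH -mulgA.
exists (gmorphism_of nfM) => i ni.
by rewrite -[adj i]mul1g [LHS]nfS // coxeter_nf1 // mul1g.
Qed.

End CoxeterMorphism.

Lemma coxeter_path_morphism (G : groupType) n (t : nat -> G) (p : 'I_n.+1 -> 'I_n.+1) :
  coxeter_rel n t -> injective p ->
  exists f : {gmorphism {perm 'I_n.+1} -> G},
    forall i, i < n -> f (tperm (p (inord i)) (p (inord i.+1))) = t i.
Proof.
move=> /coxeter_morphism[f ft] p_inj; pose q := (perm p_inj)^-1.
have fM : {morph (fun s => f (s ^ q)) : s s' / s * s'}.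
  by move=> s s'; rewrite conjMg gmulfM.
exists (gmorphism_of fM) => i ni; rewrite /= -ft // tpermJ.
by congr (f (tperm _ _)); apply: (canLR (permK _)); rewrite permE.
Qed.

(** * Translation families over a symmetric group *)

(* Inequalities read off hypotheses [uniq _] and [_ \notin _]. *)
Ltac distinct :=
  repeat match goal with
  | H : is_true (uniq (_ :: _)) |- _ => move: H; rewrite /= ?inE ?negb_or -?andbA => H
  | H : is_true (_ \notin _ :: _) |- _ => move: H; rewrite ?inE ?negb_or -?andbA => H
  | H : is_true (_ && _) |- _ => case/andP: H => ? ?
  end;
  rewrite /= ?inE ?negb_or ?andbT -?andbA; repeat (apply/andP; split);
  solve [done | by rewrite eq_sym].

Lemma fresh_exists (T : finType) (l : seq T) : size l < #|T| -> exists p, p \notin l.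
Proof.
move=> lT; apply/existsP; apply: contraTT lT; rewrite negb_exists -leqNgt => /forallP Tl.
by apply: leq_trans (card_size l); apply/subset_leq_card/subsetP => p _; apply/negPn/Tl.
Qed.

Section Translations.
Variables (T : finType) (G : groupType) (iota : {gmorphism {perm T} -> G}).
Implicit Types (p q r : T) (s : {perm T}) (w : G) (X Y A : T -> T -> G).

Definition tau p q : G := iota (tperm p q).

Lemma tauC p q : tau p q = tau q p.
Proof. by rewrite /tau tpermC. Qed.

Lemma tau1 p : tau p p = 1.
Proof. by rewrite /tau tperm1 gmulf1. Qed.

Lemma tau2 p q : tau p q * tau p q = 1.
Proof. by rewrite -gmulfM tperm2 gmulf1. Qed.

Lemma tauJ s p q : tau p q ^ iota s = tau (s p) (s q).
Proof. by rewrite -gmulfJ tpermJ. Qed.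

Lemma commute_tau_trans w p q r :
  commute w (tau p q) -> commute w (tau q r) -> commute w (tau p r).
Proof.
apply: (tperm_trans (P := fun s => commute w (iota s))) => [|s t].
  by rewrite gmulf1; apply: commute1.
by rewrite gmulfM; apply: commuteM.
Qed.

Lemma commute_perm_on w (A : {set T}) s :
  {in A &, forall p q, commute w (tau p q)} -> perm_on A s -> commute w (iota s).
Proof.
move=> wA; elim/perm_on_ind: s / => [|s p q pA qA ws].
  by rewrite gmulf1; apply: commute1.
by rewrite gmulfM; apply: commuteM (wA _ _ pA qA).
Qed.

Definition equivariant A : Prop :=
  forall s p q, p != q -> A p q ^ iota s = A (s p) (s q).

Definition translations X : Prop :=
  [/\ forall p q r, X p q * X q r = X p r,
      forall p q p' q', commute (X p q) (X p' q') &
      forall s p q, X p q ^ iota s = X (s p) (s q)].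

Definition reflection X p q : G := tau p q * X p q.

Lemma equivariant_exists w p0 q0 : p0 != q0 ->
  (forall p q, p \notin [:: p0; q0] -> q \notin [:: p0; q0] -> commute w (tau p q)) ->
  exists2 A, equivariant A & A p0 q0 = w.
Proof.
move=> pq0 w_tau; have w_stab s : s p0 = p0 -> s q0 = q0 -> commute w (iota s).
  move=> sp sq; apply: (@commute_perm_on w [set p | p \notin [:: p0; q0]]).
    by move=> p q; rewrite !in_set; apply: w_tau.
  apply/subsetP => p sp'; rewrite in_set; apply: contraNN sp'.
  by rewrite !inE => /orP[] /eqP ->; apply/eqP.
pose mover p q := odflt 1 [pick s : {perm T} | (s p0 == p) && (s q0 == q)].
have moverP p q : p != q -> mover p q p0 = p /\ mover p q q0 = q.
  move=> pq; rewrite /mover; case: pickP => [s /andP[/eqP-> /eqP->] //|none].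
  have [s [sp sq]] : exists s : {perm T}, map s [:: p0; q0] = [:: p; q].
    by apply: perm_map_exists; distinct.
  by have := none s; rewrite sp sq !eqxx.
have moverE s p q : p != q -> s p0 = p -> s q0 = q -> w ^ iota s = w ^ iota (mover p q).
  move=> pq sp sq; have [mp mq] := moverP _ _ pq.
  rewrite -(mulgVK (mover p q) s) gmulfM conjgM; congr (_ ^ _).
  apply/commute_conjgP/w_stab; rewrite permM ?sp ?sq; apply: (canLR (permK _));
    by rewrite ?mp ?mq.
exists (fun p q => w ^ iota (mover p q)) => [s p q pq|].
  have [mp mq] := moverP _ _ pq; rewrite -conjgM -gmulfM; apply: moverE.
  - by rewrite (inj_eq perm_inj).
  - by rewrite permM mp.
  - by rewrite permM mq.
by rewrite -(moverE 1) ?perm1 // gmulf1 conjg1.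
Qed.

Section EquivariantInverses.
Variable X : T -> T -> G.
Hypothesis XJ : forall s p q, X p q ^ iota s = X (s p) (s q).
Hypothesis XV : forall p q, (X p q)^-1 = X q p.

Lemma tauJ_reflectionR p q r : uniq [:: p; q; r] ->
  tau q r ^ reflection X p q = tau p r * (X q r * X p q).
Proof.
move=> u; rewrite conjgM tauJ tpermR tpermD; try distinct.
by rewrite conjgV_involution ?tau2 // XV XJ tpermL tpermD //; distinct.
Qed.

Lemma tauJ_reflectionL p q r : uniq [:: p; q; r] ->
  tau p r ^ reflection X p q = tau q r * (X r p * X p q).
Proof.
move=> u; rewrite conjgM tauJ tpermL tpermD; try distinct.
by rewrite conjgV_involution ?tau2 // XV XJ tpermL tpermD //; distinct.
Qed.

Lemma translations_of_triples : (forall p, X p p = 1) ->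
  (forall p q r, uniq [:: p; q; r] -> X p q * X q r = X p r /\ X q r * X p q = X p r) ->
  translations X.
Proof.
move=> X1 Xpqr; have XD p q r : X p q * X q r = X p r.
  have [->|pq] := eqVneq p q; first by rewrite X1 mul1g.
  have [->|qr] := eqVneq q r; first by rewrite X1 mulg1.
  have [<-|pr] := eqVneq p r; first by rewrite -XV mulVg X1.
  by have [|-> //] := Xpqr p q r; distinct.
have Xadj p q r : commute (X p q) (X q r).
  have [->|pq] := eqVneq p q; first by rewrite X1; apply/commute_sym/commute1.
  have [->|qr] := eqVneq q r; first by rewrite X1; apply/commute1.
  have [<-|pr] := eqVneq p r; first by rewrite /commute !XD !X1.
  by have [|e1 e2] := Xpqr p q r; [distinct | rewrite /commute e1 e2].
split=> // p q p' q'; rewrite -(XD p' p q'); apply: commuteM; first exact/commute_sym/Xadj.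
by rewrite -XV; apply/commute_sym/commuteV/commute_sym/Xadj.
Qed.

End EquivariantInverses.

Definition shift_of A p q : G := if p == q then 1 else tau p q * A p q.

Lemma reflection_shift_of A p q : p != q -> reflection (shift_of A) p q = A p q.
Proof. by rewrite /reflection /shift_of => /negPf ->; rewrite mulgA tau2 mul1g. Qed.

Lemma translations_shift_of A : equivariant A ->
  (forall p q, p != q -> A p q * A p q = 1) ->
  (forall p q r, uniq [:: p; q; r] -> tau q r ^ A p q = A p r) ->
  (forall p q r, uniq [:: p; q; r] -> tau p r ^ A p q = A r q) ->
  translations (shift_of A).
Proof.
move=> AJ A2 A_tauR A_tauL; set X := shift_of A.
have XJ s p q : X p q ^ iota s = X (s p) (s q).
  rewrite /X /shift_of (inj_eq perm_inj); case: eqVneq => [_|pq]; first exact: conj1g.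
  by rewrite conjMg tauJ AJ.
have XV p q : (X p q)^-1 = X q p.
  rewrite /X /shift_of [q == p]eq_sym; have [_|pq] := eqVneq p q; first exact: invg1.
  have -> : A q p = A p q ^ tau p q by rewrite AJ // tpermL tpermR.
  rewrite conjg_involution ?tau2 // invgM (mulg1_eq (tau2 p q)) (mulg1_eq (A2 _ _ pq)).
  by rewrite tauC !mulgA tau2 mul1g.
apply: translations_of_triples => // [p|p q r u]; first by rewrite /X /shift_of eqxx.
have [pq pr qr] : [/\ p != q, p != r & q != r] by split; distinct.
split.
  have u' : uniq [:: q; r; p] by distinct.
  apply: (mulgI (tau r p)); rewrite -(tauJ_reflectionL XJ XV u') reflection_shift_of //.
  by rewrite A_tauL // -reflection_shift_of // tauC.
apply: (mulgI (tau p r)); rewrite -(tauJ_reflectionR XJ XV u) reflection_shift_of //.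
by rewrite A_tauR // -reflection_shift_of.
Qed.

Lemma translations_exist w p0 q0 r1 r2 :
  uniq [:: p0; q0; r1] -> uniq [:: p0; q0; r2] -> w * w = 1 ->
  (forall p q, p \notin [:: p0; q0] -> q \notin [:: p0; q0] -> commute w (tau p q)) ->
  tau q0 r1 ^ w = w ^ tau q0 r1 -> tau p0 r2 ^ w = w ^ tau p0 r2 ->
  exists2 X, translations X & reflection X p0 q0 = w.
Proof.
move=> u1 u2 ww w_tau w_tauR w_tauL; have pq0 : p0 != q0 by distinct.
have [A AJ A0] := equivariant_exists pq0 w_tau.
exists (shift_of A); last by rewrite reflection_shift_of.
apply: translations_shift_of => // [p q pq|p q r u|p q r u].
- have [s [<- <-]] : exists s : {perm T}, map s [:: p0; q0] = [:: p; q].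
    by apply: perm_map_exists; distinct.
  by rewrite -AJ // -conjMg A0 ww conj1g.
- have [s [<- <- <-]] := perm_map_exists u1 u erefl.
  have pr0 : p0 != r1 by distinct.
  rewrite -tauJ -!AJ // -conjJg; congr (_ ^ _); rewrite A0 w_tauR -A0 AJ // tpermL tpermD //;
    distinct.
- have [s [<- <- <-]] := perm_map_exists u2 u erefl.
  have rq0 : r2 != q0 by distinct.
  rewrite -tauJ -!AJ // -conjJg; congr (_ ^ _); rewrite A0 w_tauL -A0 AJ // tpermL tpermD //;
    distinct.
Qed.

Section OneFamily.
Variable X : T -> T -> G.
Hypothesis X_trans : translations X.

Lemma translationD p q r : X p q * X q r = X p r.
Proof. by case: X_trans. Qed.

Lemma commute_translation p q p' q' : commute (X p q) (X p' q').
Proof. by case: X_trans. Qed.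

Lemma translationJ s p q : X p q ^ iota s = X (s p) (s q).
Proof. by case: X_trans. Qed.

Lemma translation1 p : X p p = 1.
Proof. by apply: (mulgI (X p p)); rewrite translationD mulg1. Qed.

Lemma translationV p q : (X p q)^-1 = X q p.
Proof. by apply: mulg1_eq; rewrite translationD translation1. Qed.

Lemma translation_reflection p q : X p q = tau p q * reflection X p q.
Proof. by rewrite mulgA tau2 mul1g. Qed.

Lemma reflectionJ s p q : reflection X p q ^ iota s = reflection X (s p) (s q).
Proof. by rewrite conjMg tauJ translationJ. Qed.

Lemma tau_reflectionR p q r : uniq [:: p; q; r] ->
  tau q r ^ reflection X p q = reflection X p r.
Proof.
move=> u; rewrite (tauJ_reflectionR translationJ translationV u).
by rewrite commute_translation translationD.
Qed.

Lemma tau_reflectionL p q r : uniq [:: p; q; r] ->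
  tau p r ^ reflection X p q = reflection X r q.
Proof.
move=> u; rewrite (tauJ_reflectionL translationJ translationV u).
by rewrite translationD tauC.
Qed.

End OneFamily.

Lemma translations_trivial : translations (fun _ _ => 1).
Proof. by split=> *; rewrite ?mulg1 ?conj1g //; apply: commute1. Qed.

Section ReflectionPairs.
Variables X Y : T -> T -> G.
Hypothesis X_trans : translations X.
Hypothesis Y_trans : translations Y.

Lemma reflection_conjJ s p q p' q' :
  (reflection Y p q ^ reflection X p' q') ^ iota s =
  reflection Y (s p) (s q) ^ reflection X (s p') (s q').
Proof. by rewrite conjJg !reflectionJ. Qed.

Lemma commute_translations_of_reflections p q r (s : T) : uniq [:: p; q; r; s] ->
  commute (reflection X p q) (reflection Y r s) -> commute (X p q) (Y r s).
Proof.
move=> u XY_refl; have tau_comm : commute (tau p q) (tau r s).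
  by apply/commute_conjgP; rewrite tauJ !tpermD //; distinct.
have tau_Y : commute (tau p q) (reflection Y r s).
  apply/commute_sym/commute_conjgP; rewrite reflectionJ // !tpermD //; distinct.
have tau_X : commute (tau r s) (reflection X p q).
  apply/commute_sym/commute_conjgP; rewrite reflectionJ // !tpermD //; distinct.
rewrite (translation_reflection X) (translation_reflection Y).
by apply: commuteM; apply/commute_sym/commuteM => //; apply: commute_sym.
Qed.

Lemma commute_translation_product p q r (s : T) : uniq [:: p; q; r; s] ->
  reflection Y p r ^ reflection X p q = reflection Y q s ^ reflection X r s ->
  commute (X q p * X r s) (Y q r).
Proof.
move=> u; rewrite [reflection X p q]/reflection [reflection X r s]/reflection !conjgM.
rewrite !reflectionJ // !tpermL; have -> : tperm p q r = r by rewrite tpermD //; distinct.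
have -> : tperm r s q = q by rewrite tpermD //; distinct.
rewrite tpermR.
move=> conj_eq; pose W := X p q * X s r.
have B_W : commute (reflection Y q r) W.
  apply/commute_conjgP; rewrite conjgM conj_eq -conjgM (translationD X_trans).
  by rewrite (translation1 X_trans) conjg1.
have W_tau : commute W (tau q r).
  apply/commute_conjgP; rewrite conjMg !(translationJ X_trans) tpermL tpermR.
  rewrite !tpermD; try distinct.
  rewrite -(translationD X_trans p q r) -mulgA (commute_translation X_trans q r).
  by rewrite (translationD X_trans).
have -> : X q p * X r s = W^-1.
  by rewrite invgM !(translationV X_trans) (commute_translation X_trans).
apply/commute_sym/commuteV; rewrite (translation_reflection Y).
by apply/commute_sym/commuteM => //; apply: commute_sym.
Qed.

End ReflectionPairs.

Section TwoFamilies.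
Variables X Y : T -> T -> G.
Hypothesis card_gt5 : 5 < #|T|.
Hypothesis X_trans : translations X.
Hypothesis Y_trans : translations Y.
Hypothesis XY_commute : forall p q r (s : T), uniq [:: p; q; r; s] -> commute (X p q) (Y r s).
Hypothesis XXY_commute : forall p q r (s : T), uniq [:: p; q; r; s] ->
  commute (X q p * X r s) (Y q r).
Let commX := commute_translation X_trans.
Let commY := commute_translation Y_trans.

Lemma fresh_exists5 (l : seq T) : size l <= 5 -> exists p, p \notin l.
Proof. by move=> l5; apply: fresh_exists; apply: leq_ltn_trans card_gt5. Qed.

Lemma commg_translations_indep p q r q' r' : uniq [:: p; q; r] -> uniq [:: p; q'; r'] ->
  [~ X p q, Y p r] = [~ X p q', Y p r'].
Proof.
have moveX k a b : uniq [:: p; a; b; k] -> [~ X p a, Y p b] = [~ X p k, Y p b].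
  move=> u; rewrite -(translationD X_trans p k a) (commX p k) commMg_commute //.
  by apply: XY_commute; distinct.
have moveY k a b : uniq [:: p; a; b; k] -> [~ X p a, Y p b] = [~ X p a, Y p k].
  move=> u; rewrite -(translationD Y_trans p k b) (commY p k) commgM_commute //.
  by apply: XY_commute; distinct.
move=> u u'; have [k k_new] := @fresh_exists5 [:: p; q; r; q'; r'] isT.
rewrite (moveX k q r) ?(moveX k q' r'); try distinct.
have [->//|rr'] := eqVneq r r'; apply: moveY; distinct.
Qed.

Lemma commg_translations_exist : exists c : T -> G,
  forall p q r, uniq [:: p; q; r] -> [~ X p q, Y p r] = c p.
Proof.
pose qr p := [pick qr : T * T | uniq [:: p; qr.1; qr.2]].
exists (fun p => if qr p is Some (q, r) then [~ X p q, Y p r] else 1) => p q r u.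
rewrite /qr; case: pickP => [[q' r'] /= u'|/(_ (q, r))]; last by rewrite u.
exact: commg_translations_indep.
Qed.

Section CommonCommutator.
Variable c : T -> G.
Hypothesis XYc : forall p q r, uniq [:: p; q; r] -> [~ X p q, Y p r] = c p.

Lemma commute_commg_translations w p (l : seq T) : size l <= 2 ->
  (forall q, q \notin p :: l -> commute w (X p q)) ->
  (forall r, r \notin p :: l -> commute w (Y p r)) -> commute w (c p).
Proof.
move=> l2 wX wY; have [q q_new] : exists q, q \notin p :: l by apply: fresh_exists5 => /=; lia.
have [r r_new] : exists r, r \notin q :: p :: l by apply: fresh_exists5 => /=; lia.
have /andP[rq rp_new] : (r != q) && (r \notin p :: l) by move: r_new; rewrite inE negb_or.
by rewrite -(@XYc p q r); [apply: commute_commg; [apply: wX | apply: wY] | distinct].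
Qed.

Lemma commute_translationX_commg p i j : i != p -> j != p -> commute (X i j) (c p).
Proof.
move=> ip jp; have [->|ij] := eqVneq i j.
  by rewrite (translation1 X_trans); apply/commute_sym/commute1.
apply: (@commute_commg_translations _ _ [:: i; j]) => // r r_new.
by apply: XY_commute; distinct.
Qed.

Lemma commute_translationY_commg p i j : i != p -> j != p -> commute (Y i j) (c p).
Proof.
move=> ip jp; have [->|ij] := eqVneq i j.
  by rewrite (translation1 Y_trans); apply/commute_sym/commute1.
apply: (@commute_commg_translations _ _ [:: i; j]) => // q q_new.
by apply/commute_sym/XY_commute; distinct.
Qed.

(* [Y q r] fixes [X q p * X r s], but multiplies the first factor by [c q] and
   the second by the inverse of [c r ^ Y q r]. *)
Lemma commg_translations_conj q r : q != r -> c q = c r ^ Y q r.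
Proof.
move=> qr; have [p p_new] := @fresh_exists5 [:: q; r] isT.
have [s s_new] := @fresh_exists5 [:: q; r; p] isT.
have Xqp : X q p ^ Y q r = X q p * c q by rewrite conjg_commg XYc //; distinct.
have Xrs : X r s ^ Y q r = X r s * (c r ^ Y q r)^-1.
  rewrite -(@XYc r s q); last by distinct.
  rewrite commgEl conjMg conjVg -conjgM (translationD Y_trans) (translation1 Y_trans).
  by rewrite conjg1 invgM invgK mulVKg.
have /commute_conjgP : commute (X q p * X r s) (Y q r) by apply: XXY_commute; distinct.
have cX : commute (X r s) (c q) by apply: commute_translationX_commg; distinct.
rewrite conjMg Xqp Xrs -mulgA => /mulgI; rewrite mulgA -cX -mulgA.
by rewrite -[RHS]mulg1 => /mulgI/divg1_eq.
Qed.

Lemma commg_translations_const q r : c q = c r.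
Proof.
have [->//|qr] := eqVneq q r; have [s s_new] := @fresh_exists5 [:: q; r] isT.
rewrite (@commg_translations_conj q s) 1?(@commg_translations_conj r s); try distinct.
rewrite -(translationD Y_trans q r s) conjgM; congr (_ ^ _).
by apply/commute_conjgP/commute_sym/commute_translationY_commg; distinct.
Qed.

End CommonCommutator.

Lemma central_commg_exists : exists z : G,
  [/\ forall p q r, uniq [:: p; q; r] -> [~ X p q, Y p r] = z,
      forall p q, commute z (X p q), forall p q, commute z (Y p q) &
      forall s, commute z (iota s)].
Proof.
have [c XYc] := commg_translations_exist; have [o _] := @fresh_exists5 [::] isT.
have cE p : c o = c p := commg_translations_const XYc o p.
exists (c o); split=> [p q r u|p q|p q|s].
- by rewrite (cE p) XYc.
- have [r r_new] := @fresh_exists5 [:: p; q] isT.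
  by rewrite (cE r); apply/commute_sym/(commute_translationX_commg XYc); distinct.
- have [r r_new] := @fresh_exists5 [:: p; q] isT.
  by rewrite (cE r); apply/commute_sym/(commute_translationY_commg XYc); distinct.
- have [q q_new] := @fresh_exists5 [:: o] isT; have [r r_new] := @fresh_exists5 [:: o; q] isT.
  have u : uniq [:: o; q; r] by distinct.
  apply/commute_conjgP; rewrite -{1}(XYc _ _ _ u) conjRg !translationJ // (cE (s o)).
  by apply: XYc; rewrite -[[:: _; _; _]]/(map s [:: o; q; r]) (map_inj_uniq perm_inj).
Qed.

End TwoFamilies.
End Translations.

(** * The Heisenberg group and its semidirect product with the symmetric group *)

Section HeisenbergGroup.
Local Open Scope ring_scope.
Variables (R : comNzRingType) (n : nat).
Implicit Types v w : 'M[R]_(2, n).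

Definition hform v w : R := (v *m w^T) 0 1.

Lemma hformDl v v' w : hform (v + v') w = hform v w + hform v' w.
Proof. by rewrite /hform mulmxDl mxE. Qed.

Lemma hformDr v w w' : hform v (w + w') = hform v w + hform v w'.
Proof. by rewrite /hform linearD mulmxDr mxE. Qed.

Lemma hformNl v w : hform (- v) w = - hform v w.
Proof. by rewrite /hform mulNmx mxE. Qed.

Lemma hformNr v w : hform v (- w) = - hform v w.
Proof. by rewrite /hform linearN mulmxN mxE. Qed.

Lemma hform0l w : hform 0 w = 0.
Proof. by rewrite /hform mul0mx mxE. Qed.

Lemma hform0r v : hform v 0 = 0.
Proof. by rewrite /hform linear0 mulmx0 mxE. Qed.

Lemma hform_perm (s : 'S_n) v w : hform (v *m perm_mx s) (w *m perm_mx s) = hform v w.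
Proof.
rewrite /hform trmx_mul -mulmxA (mulmxA (perm_mx s)) tr_perm_mx.
by rewrite -perm_mxM mulgV perm_mx1 mul1mx.
Qed.

Record heis := Heis { hvec : 'M[R]_(2, n); hcen : R }.

Definition pair_of_heis h := (hvec h, hcen h).
Definition heis_of_pair vc := Heis vc.1 vc.2.

Lemma pair_of_heisK : cancel pair_of_heis heis_of_pair.
Proof. by case. Qed.

HB.instance Definition _ := Choice.copy heis (can_type pair_of_heisK).

Lemma heis_eq h h' : hvec h = hvec h' -> hcen h = hcen h' -> h = h'.
Proof. by case: h h' => [v c] [v' c'] /= -> ->. Qed.

Definition heis_mul h h' :=
  Heis (hvec h + hvec h') (hcen h + hcen h' - hform (hvec h') (hvec h)).
Definition heis_one := Heis 0 0.
Definition heis_inv h := Heis (- hvec h) (- hcen h - hform (hvec h) (hvec h)).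

Lemma heis_mulA : associative heis_mul.
Proof. by move=> h1 h2 h3; apply: heis_eq; rewrite /= ?addrA // hformDl hformDr; ring. Qed.

Lemma heis_mul1 : left_id heis_one heis_mul.
Proof. by move=> h; apply: heis_eq; rewrite /= ?hform0r ?subr0 add0r. Qed.

Lemma heis_1mul : right_id heis_one heis_mul.
Proof. by move=> h; apply: heis_eq; rewrite /= ?hform0l ?subr0 addr0. Qed.

Lemma heis_mulV : left_inverse heis_one heis_inv heis_mul.
Proof. by move=> h; apply: heis_eq; rewrite /= ?addNr // hformNr; ring. Qed.

Lemma heis_Vmul : right_inverse heis_one heis_inv heis_mul.
Proof. by move=> h; apply: heis_eq; rewrite /= ?addrN // hformNl; ring. Qed.

HB.instance Definition _ :=
  isGroup.Build heis heis_mulA heis_mul1 heis_1mul heis_mulV heis_Vmul.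

Lemma heisM v c v' c' :
  (Heis v c * Heis v' c')%g = Heis (v + v') (c + c' - hform v' v).
Proof. by []. Qed.

Lemma heisV v c : (Heis v c)^-1%g = Heis (- v) (- c - hform v v).
Proof. by []. Qed.

Definition heis_x i : heis := Heis (delta_mx 0 i) 0.
Definition heis_y i : heis := Heis (delta_mx 1 i) 0.
Definition heis_z : heis := Heis 0 1.

Lemma hform_delta (k l : 'I_2) i j :
  hform (delta_mx k i) (delta_mx l j) = ((k == 0) && (l == 1) && (i == j))%:R.
Proof.
rewrite /hform trmx_delta mul_delta_mx_cond mulmxnE mxE -mulrnA mulnb.
by rewrite [k == 0]eq_sym [l == 1]eq_sym.
Qed.

Lemma heis_central c h : commute (Heis 0 c) h.
Proof. by apply: heis_eq; rewrite /= ?hform0l ?hform0r ?subr0 addrC. Qed.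

Lemma heis_xx i j : [~ heis_x i, heis_x j]%g = 1%g.
Proof. by apply/eqP/commgP; rewrite /commute !heisM !hform_delta addrC. Qed.

Lemma heis_yy i j : [~ heis_y i, heis_y j]%g = 1%g.
Proof. by apply/eqP/commgP; rewrite /commute !heisM !hform_delta addrC. Qed.

Lemma heis_xy i j : [~ heis_x i, heis_y j]%g = Heis 0 (i == j)%:R.
Proof.
apply: (mulgI (heis_y j * heis_x i)%g); rewrite -commgC !heisM hform0l !hform_delta /=.
by rewrite !addr0 [in RHS]addrC !subr0 add0r addNr.
Qed.

Definition heis_perm (s : 'S_n) h : heis := Heis (hvec h *m perm_mx s) (hcen h).

Lemma heis_permM s : {morph heis_perm s : h h' / (h * h')%g}.
Proof. by move=> h h'; apply: heis_eq; rewrite /= ?mulmxDl // hform_perm. Qed.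

Lemma heis_perm_comp s s' h : heis_perm (s * s')%g h = heis_perm s' (heis_perm s h).
Proof. by apply: heis_eq; rewrite //= perm_mxM mulmxA. Qed.

Lemma heis_perm1 h : heis_perm 1%g h = h.
Proof. by apply: heis_eq; rewrite //= perm_mx1 mulmx1. Qed.

End HeisenbergGroup.

Arguments heis_x {R n}.
Arguments heis_y {R n}.
Arguments heis_z {R n}.

Section PermHeisenberg.
Local Open Scope group_scope.
Variables (R : comNzRingType) (n : nat).
Local Notation heis := (heis R n).

Record pheis := PHeis { pperm : 'S_n; pheisen : heis }.

Definition pair_of_pheis m := (pperm m, pheisen m).
Definition pheis_of_pair sh := PHeis sh.1 sh.2.

Lemma pair_of_pheisK : cancel pair_of_pheis pheis_of_pair.
Proof. by case. Qed.

HB.instance Definition _ := Choice.copy pheis (can_type pair_of_pheisK).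

Definition pheis_mul m m' :=
  PHeis (pperm m * pperm m') (heis_perm (pperm m') (pheisen m) * pheisen m').
Definition pheis_one := PHeis 1 1.
Definition pheis_inv m := PHeis (pperm m)^-1 (heis_perm (pperm m)^-1 (pheisen m)^-1).

Let heis_perm_one s : heis_perm s 1 = 1 :> heis.
Proof. exact: morphM_morph1 (@heis_permM _ _ s). Qed.

Lemma pheis_mulA : associative pheis_mul.
Proof.
by move=> m1 m2 m3; rewrite /pheis_mul /= heis_perm_comp heis_permM !mulgA.
Qed.

Lemma pheis_mul1 : left_id pheis_one pheis_mul.
Proof. by case=> s h; rewrite /pheis_mul /= heis_perm_one !mul1g. Qed.

Lemma pheis_1mul : right_id pheis_one pheis_mul.
Proof. by case=> s h; rewrite /pheis_mul /= heis_perm1 !mulg1. Qed.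

Lemma pheis_mulV : left_inverse pheis_one pheis_inv pheis_mul.
Proof.
by case=> s h; rewrite /pheis_mul /= -heis_perm_comp mulVg heis_perm1 mulVg.
Qed.

Lemma pheis_Vmul : right_inverse pheis_one pheis_inv pheis_mul.
Proof.
by case=> s h; rewrite /pheis_mul /= -heis_permM !mulgV heis_perm_one.
Qed.

HB.instance Definition _ :=
  isGroup.Build pheis pheis_mulA pheis_mul1 pheis_1mul pheis_mulV pheis_Vmul.

Lemma pheisM s h s' h' :
  PHeis s h * PHeis s' h' = PHeis (s * s') (heis_perm s' h * h').
Proof. by []. Qed.

Lemma sym_in_morph : {morph (fun s => PHeis s 1) : s s' / s * s'}.
Proof. by move=> s s'; rewrite pheisM heis_perm_one mulg1. Qed.

Lemma heis_in_morph : {morph PHeis 1 : h h' / h * h'}.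
Proof. by move=> h h'; rewrite pheisM heis_perm1 mulg1. Qed.

Definition sym_in : {gmorphism 'S_n -> pheis} := gmorphism_of sym_in_morph.
Definition heis_in : {gmorphism heis -> pheis} := gmorphism_of heis_in_morph.

Lemma pheisE s h : PHeis s h = sym_in s * heis_in h.
Proof. by rewrite pheisM heis_perm_one mulg1 mul1g. Qed.

Lemma heis_inJ h s : heis_in h ^ sym_in s = heis_in (heis_perm s h).
Proof. by apply: (mulgI (sym_in s)); rewrite -conjgC -pheisE pheisM mul1g mulg1. Qed.

Lemma commute_heis_center c m : commute (heis_in (Heis 0%R c)) m.
Proof.
case: m => s h; rewrite pheisE; apply: commuteM.
  by apply/commute_conjgP; rewrite heis_inJ /heis_perm mul0mx.
by rewrite /commute -!gmulfM (heis_central c h).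
Qed.

End PermHeisenberg.

Arguments sym_in {R n}.
Arguments heis_in {R n}.

Section Reflections.
Local Open Scope ring_scope.
Variables (R : comNzRingType) (n : nat).
Implicit Types (p q : 'I_n) (s : 'S_n) (w : 'cV[R]_2) (v phi : 'M[R]_(2, n)).

Definition dvec p q : 'rV[R]_n := delta_mx 0 q - delta_mx 0 p.

Lemma delta_perm m (k : 'I_m) s p :
  delta_mx k p *m perm_mx s = delta_mx k (s p) :> 'M[R]_(m, n).
Proof.
rewrite -[s in LHS]invgK -col_permE; apply/matrixP => i j.
by rewrite !mxE (can2_eq (permKV s) (permK s)).
Qed.

Lemma dvec_perm s p q : dvec p q *m perm_mx s = dvec (s p) (s q).
Proof. by rewrite mulmxBl !delta_perm. Qed.

Lemma dvecC p q : dvec q p = - dvec p q.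
Proof. by rewrite opprB. Qed.

Lemma dvec_id p : dvec p p = 0.
Proof. exact: subrr. Qed.

Lemma mulmx_dvecT m (A : 'M[R]_(m, n)) p q : A *m (dvec p q)^T = col q A - col p A.
Proof. by rewrite [(dvec p q)^T]linearB /= mulmxBr !trmx_delta -!colE. Qed.

Lemma mulmx_tperm m (A : 'M[R]_(m, n)) p q :
  A *m perm_mx (tperm p q) = A - (col q A - col p A) *m dvec p q.
Proof.
rewrite -{1}(tpermV p q) -col_permE; apply/matrixP => i j.
rewrite !mxE big_ord1 !mxE eqxx /=; case: tpermP => [->|->|/eqP jp /eqP jq].
- by rewrite eqxx; case: eqVneq => [->|_] /=; ring.
- by rewrite eqxx; case: eqVneq => [->|_] /=; ring.
- by rewrite (negPf jp) (negPf jq) /=; ring.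
Qed.

Lemma hform_dvec v w p q :
  hform v (w *m dvec p q) = (col q v - col p v) 0 0 * w 1 0.
Proof. by rewrite /hform trmx_mul mulmxA mulmx_dvecT mxE big_ord1 !mxE. Qed.

Lemma dvecE p q i : dvec p q 0 i = (i == q)%:R - (i == p)%:R.
Proof. by rewrite !mxE. Qed.

Lemma hform_mul_dvec w w' p q p' q' : hform (w *m dvec p q) (w' *m dvec p' q') =
  w 0 0 * w' 1 0 * (dvec p q 0 q' - dvec p q 0 p').
Proof. by rewrite hform_dvec !mxE !big_ord1 !mxE; ring. Qed.

(* The central coordinate is the only one for which the square is trivial. *)
Definition refl p q w : pheis R n :=
  PHeis (tperm p q) (Heis (w *m dvec p q) (- (w 0 0 * w 1 0))).

Lemma refl0 p q : refl p q 0 = sym_in (tperm p q).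
Proof. by rewrite /refl mul0mx mxE mul0r oppr0. Qed.

Lemma reflC p q w : refl q p w = refl p q (- w).
Proof. by rewrite /refl tpermC dvecC !mxE mulmxN mulNmx mulrNN. Qed.

Lemma reflJ s p q w : (refl p q w ^ sym_in s)%g = refl (s p) (s q) w.
Proof.
rewrite /refl !pheisE conjMg -gmulfJ tpermJ heis_inJ; congr (_ * heis_in _)%g.
by rewrite /heis_perm /= -mulmxA dvec_perm.
Qed.

Definition gauge phi : pheis R n := heis_in (Heis phi 0).

Lemma sym_in_tperm_gauge p q phi :
  (sym_in (tperm p q) ^ gauge phi)%g = refl p q (col q phi - col p phi).
Proof.
rewrite conjgV_involution; last by rewrite -gmulfM tperm2 gmulf1.
rewrite /refl [RHS]pheisE -gmulfV heis_inJ -gmulfM; congr (_ * heis_in _)%g.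
rewrite heisV /heis_perm /= heisM mulNmx mulmx_tperm; set w := col q phi - col p phi.
congr Heis; first by rewrite opprB subrK.
rewrite opprB hformDr hformNr hform_dvec; ring.
Qed.

Lemma gauged_morph phi : {morph (fun s => sym_in s ^ gauge phi)%g : s s' / (s * s')%g}.
Proof. by move=> s s'; rewrite gmulfM conjMg. Qed.

Definition gauged phi : {gmorphism 'S_n -> pheis R n} := gmorphism_of (gauged_morph phi).

Lemma pperm_gauged phi s : pperm (gauged phi s) = s.
Proof. by rewrite /= invg1 mul1g mulg1. Qed.

(* Reflections along edges whose displacements are the increments of a potential
   are simultaneously conjugate to transpositions. *)
Lemma gauged_tperm p q phi w : col q phi - col p phi = w ->
  gauged phi (tperm p q) = refl p q w.
Proof. by move<-; apply: sym_in_tperm_gauge. Qed.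

Lemma col_mul_delta w p q : col q (w *m delta_mx 0 p) = if q == p then w else 0.
Proof.
apply/colP => i; rewrite !mxE big_ord1 !mxE eqxx /=.
by case: eqP => _; rewrite ?mulr1 // mulr0 mxE.
Qed.

Lemma potential_exists p q w : p != q -> exists phi, col q phi - col p phi = w.
Proof.
move=> pq; exists (w *m delta_mx 0 q).
by rewrite !col_mul_delta eqxx (negPf pq) subr0.
Qed.

Lemma pair_potential_exists p q p' q' w w' : p != q -> p' != q' ->
  (p' \notin [:: p; q]) || (q' \notin [:: p; q]) ->
  exists phi, col q phi - col p phi = w /\ col q' phi - col p' phi = w'.
Proof.
move=> pq; wlog q'_new : p' q' w' / q' \notin [:: p; q].
  move=> IH p'q' /orP[p'_new|q'_new]; last by apply: IH => //; rewrite q'_new orbT.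
  have [||phi [phi_w phi_w']] := IH q' p' (- w') p'_new.
  - by rewrite eq_sym.
  - by rewrite p'_new orbT.
  by exists phi; split=> //; rewrite -[w']opprK -phi_w' opprB.
move=> p'q' _.
exists (w *m delta_mx 0 q + (w' + if p' == q then w else 0) *m delta_mx 0 q').
rewrite !linearD /= !col_mul_delta !eqxx; move: q'_new; rewrite !inE negb_or => /andP[q'p q'q].
rewrite (negPf pq) (negPf p'q') [q == q']eq_sym [p == q']eq_sym (negPf q'p) (negPf q'q).
by split; rewrite /= ?add0r ?addr0 ?subr0 ?addrK.
Qed.

End Reflections.

Arguments dvec {R n}.

(** * Balanced elements *)

Section Balanced.
Local Open Scope ring_scope.
Variables (R : comNzRingType) (n : nat).
Implicit Types (p q : 'I_n) (v : 'M[R]_(2, n)) (w : 'cV[R]_2) (m : pheis R n).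

Definition vsum v : 'cV[R]_2 := v *m const_mx 1.

Lemma vsumD : {morph vsum : v v' / v + v'}.
Proof. by move=> v v'; rewrite /vsum mulmxDl. Qed.

Lemma vsum_perm (s : 'S_n) v : vsum (v *m perm_mx s) = vsum v.
Proof.
rewrite /vsum -mulmxA -row_permE; congr (_ *m _).
by apply/colP => i; rewrite !mxE.
Qed.

Lemma vsum_delta (k : 'I_2) p : vsum (delta_mx k p) = delta_mx k 0.
Proof.
rewrite /vsum -(mul_delta_mx (0 : 'I_1)) -mulmxA -rowE.
by rewrite (_ : row p _ = 1%:M) ?mulmx1 //; apply/rowP => i; rewrite !mxE ord1.
Qed.

Lemma mulmx_dvec_const p q : dvec p q *m const_mx 1 = 0 :> 'cV[R]_1.
Proof. by rewrite mulmxBl -!rowE; apply/rowP => i; rewrite !mxE subrr. Qed.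

Lemma vsum_mul_dvec w p q : vsum (w *m dvec p q) = 0.
Proof. by rewrite /vsum -mulmxA mulmx_dvec_const mulmx0. Qed.

Definition balanced : {pred pheis R n} := [pred m | vsum (hvec (pheisen m)) == 0].

Lemma balancedM : {in balanced &, forall m m', (m * m')%g \in balanced}.
Proof.
move=> m m'; rewrite !inE /= vsumD vsum_perm => /eqP -> /eqP ->.
by rewrite addr0.
Qed.

Lemma balanced_refl p q w : refl p q w \in balanced.
Proof. by rewrite !inE /= vsum_mul_dvec. Qed.

Definition dmx (o : 'I_n) : 'M[R]_n := \matrix_i dvec o i.

Lemma mulmx_dmx (o : 'I_n) v : vsum v = 0 -> v *m dmx o = v.
Proof.
move=> v0; have -> : dmx o = 1%:M - const_mx 1 *m delta_mx (0 : 'I_1) o.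
  apply/matrixP => i j; rewrite !mxE big_ord1 !mxE eqxx mul1r [j == i]eq_sym.
  by [].
by rewrite mulmxBr mulmx1 mulmxA [v *m _]v0 mul0mx subr0.
Qed.

Lemma bform_dmx (o : 'I_n) v v' : vsum v = 0 -> vsum v' = 0 ->
  bform (dmx o *m (dmx o)^T) (row_x v) (row_y v') = hform v v'.
Proof.
move=> v0 v'0; rewrite /bform mulmxA -mulmxA -trmx_mul /row_x /row_y -!row_mul !mulmx_dmx //.
by rewrite /hform !mxE; apply: eq_bigr => i _; rewrite !mxE.
Qed.

End Balanced.

Arguments balanced {R n}.
Arguments dmx {R n}.

Section BalancedGeneration.
Local Open Scope ring_scope.
Variables (n : nat) (P : pheis int n -> Prop).
Hypothesis PM : forall m m', P m -> P m' -> P (m * m')%g.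
Hypothesis PV : forall m, P m -> P m^-1%g.
Hypothesis P_perm : forall s, P (sym_in s).
Hypothesis P_refl : forall (k : 'I_2) p q, p != q -> P (refl p q (delta_mx k 0)).

Let P_translation (k : 'I_2) p q : P (heis_in (Heis (delta_mx k 0 *m dvec p q) 0)).
Proof.
have [->|pq] := eqVneq p q; first by rewrite dvec_id mulmx0; apply: P_perm 1%g.
rewrite (_ : heis_in _ = (sym_in (tperm p q) * refl p q (delta_mx k 0))%g).
  by apply: PM; [apply: P_perm | apply: P_refl].
rewrite /refl pheisE mulgA -gmulfM tperm2 gmulf1 mul1g; congr (heis_in (Heis _ _)).
by rewrite !mxE; have [<-|_] := eqVneq 0 k; rewrite /= ?mul0r ?mulr0 oppr0.
Qed.

Lemma heis_center_expgz c : Heis (0 : 'M[int]_(2, n)) c = expgz heis_z c.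
Proof.
rewrite -[c in LHS]intz -(@expmapMz _ _ (fun c : int => Heis (0 : 'M_(2, n)) c)) //.
by move=> a b; rewrite heisM hform0l addr0 subr0.
Qed.

Let P_center : (2 < n)%N -> forall c, P (heis_in (Heis 0 c)).
Proof.
move=> n_gt2 c; pose o k := Ordinal (leq_trans (ltn_ord (k : 'I_3)) n_gt2).
have o_inj : injective o by move=> k l /(congr1 val) /= /val_inj.
have P1 : P 1%g := P_perm 1%g.
pose a : heis int n := Heis (delta_mx 0 0 *m dvec (o 0) (o 1)) 0.
pose b : heis int n := Heis (delta_mx 1 0 *m dvec (o 0) (o 2)) 0.
have z_comm : heis_z = [~ a, b]%g.
  apply: (mulgI (b * a)%g); rewrite -commgC !heisM hform0l !hform_mul_dvec !dvecE.
  rewrite !(inj_eq o_inj) !mxE /=; congr Heis.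
  by rewrite addr0 addrC.
have P_z : P (heis_in heis_z).
  by rewrite z_comm gmulfR commgEl conjgE; do ?apply: PM; do ?apply: PV; apply: P_translation.
rewrite heis_center_expgz gmulf_expgz; elim: c => [//|k IH|k IH].
  by rewrite -addn1 PoszD expgzSr; apply: PM.
by rewrite -addn1 PoszD opprD expgzBr; apply: PM (PV _).
Qed.

Let P_heis v : Prop := forall c, P (heis_in (Heis v c)).

Lemma balanced_ind : (2 < n)%N -> forall m, m \in balanced -> P m.
Proof.
move=> n_gt2; pose o := Ordinal (ltnW (ltnW n_gt2)); have P0 := P_center n_gt2.
have P_heisD v v' : P_heis v -> P_heis v' -> P_heis (v + v').
  move=> Pv Pv' c; have := PM (Pv (c + hform v' v)) (Pv' 0).
  by rewrite -gmulfM heisM addr0 addrK.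
have P_heisN v : P_heis v -> P_heis (- v).
  move=> Pv c; have := PV (Pv (- c - hform v v)).
  by rewrite -gmulfV heisV opprB opprK addrAC subrr add0r.
have P_heisMz v k : P_heis v -> P_heis (v *~ k).
  move=> Pv; elim: k => [|k IH|k IH]; first exact: P0.
    by rewrite intS mulrzDr; apply: P_heisD.
  by rewrite intS opprD mulrzDr; apply: P_heisD => //; apply: P_heisN.
have P_heis_dvec k p q : P_heis (delta_mx k 0 *m dvec p q).
  move=> c; have := PM (P_translation k p q) (P0 c).
  by rewrite -gmulfM heisM hform0l addr0 add0r subr0.
move=> [s [v c]]; rewrite inE => /eqP /= v0; rewrite pheisE; apply: PM => //.
move: c; rewrite -/(P_heis v) -(mulmx_dmx o v0) [v]matrix_sum_delta !mulmx_suml.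
elim/big_ind: _ => [|v1 v2|k _]; [exact: P0 | exact: P_heisD | rewrite mulmx_suml].
elim/big_ind: _ => [|v1 v2|i _]; [exact: P0 | exact: P_heisD |].
rewrite -scalemxAl -[v k i]intz scaler_int; apply: P_heisMz.
by rewrite -(mul_delta_mx (0 : 'I_1)) -mulmxA -rowE rowK.
Qed.

End BalancedGeneration.

Section BalancedCentralizer.
Local Open Scope ring_scope.
Variable n : nat.
Implicit Types (v : 'M[int]_(2, n)) (m : pheis int n).

Lemma tperm_fixed_eq0 v : vsum v = 0 ->
  (forall p q, v *m perm_mx (tperm p q) = v) -> v = 0.
Proof.
move=> v0 v_fixed; have v_const k p q : v k p = v k q.
  by have /matrixP/(_ k q) := v_fixed q p; rewrite -{1}(tpermV q p) -col_permE mxE tpermL.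
apply/matrixP => k p; rewrite mxE; have /colP/(_ k) := v0; rewrite !mxE.
under eq_bigr => q _ do rewrite (v_const k q p) mxE mulr1.
rewrite sumr_const card_ord => /eqP; rewrite mulrn_eq0 => /orP[/eqP n0|/eqP //].
by have := ltn_ord p; rewrite [X in (_ < X)%N]n0.
Qed.

Lemma commute_sym_in_balanced m : (2 < n)%N -> m \in balanced ->
  (forall s, commute m (sym_in s)) -> exists c, m = heis_in (Heis 0 c).
Proof.
case: m => s [v c] n_gt2 /eqP /= v0 m_comm; exists c.
have s1 : s = 1%g.
  apply/permP => p; rewrite perm1; apply/eqP/negPn/negP => sp.
  have [q q_new] : exists q, q \notin [:: p; s p] by apply: fresh_exists; rewrite card_ord.
  have /(congr1 (@pperm _ _)) /= := m_comm (tperm (s p) q).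
  move/(congr1 (fun t : 'S_n => t p)); rewrite !permM tpermL tpermD; try distinct.
  by move=> q_sp; rewrite q_sp !inE eqxx orbT in q_new.
rewrite s1 in m_comm *; congr (PHeis _ (Heis _ _)); apply: tperm_fixed_eq0 => // p q.
have /(congr1 (fun m => hvec (pheisen m))) /= := m_comm (tperm p q).
by rewrite addr0 mul0mx add0r.
Qed.

End BalancedCentralizer.

Section BalancedCoordinates.
Local Open Scope ring_scope.
Variables (R : comNzRingType) (n : nat) (o : 'I_n.+1).

Lemma col'_mulmx_dmx v : vsum v = 0 -> col' o v *m row' o (dmx o) = v :> 'M[R]_(2, n.+1).
Proof.
move=> v0; rewrite -[RHS](mulmx_dmx o v0); apply/matrixP => k i.
rewrite !mxE (bigD1_ord o) //= [dmx o o i]mxE dvec_id mxE mulr0 add0r.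
by apply: eq_bigr => j _; rewrite !mxE.
Qed.

Lemma mulmx_dmx_col' (w : 'M[R]_(2, n)) : col' o (w *m row' o (dmx o)) = w.
Proof.
apply/matrixP => k i; rewrite !mxE (bigD1 i) //= big1 => [|j ji]; rewrite !mxE /=.
  by rewrite eqxx [_ == o]eq_sym (negPf (neq_lift _ _)) subr0 mulr1 addr0.
rewrite (inj_eq lift_inj) [_ == o]eq_sym (negPf (neq_lift _ _)) eq_sym (negPf ji).
by rewrite subr0 mulr0.
Qed.

Lemma vsum_mulmx_dmx (w : 'M[R]_(2, n)) : vsum (w *m row' o (dmx o)) = 0.
Proof.
rewrite /vsum -mulmxA (_ : _ *m const_mx 1 = 0) ?mulmx0 //; apply/row_matrixP => i.
rewrite row_mul row0 -(mulmx_dvec_const _ o (lift o i)); congr (_ *m _).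
by apply/rowP => j; rewrite !mxE.
Qed.

End BalancedCoordinates.

Section HeisenbergNormalFormModel.
Variable n : nat.
Implicit Types (k l : 'I_2) (a b : 'rV[int]_n).

Let heis_row k a : heis int n := Heis (delta_mx k 0 *m a)%R 0%R.

Let hform_row k l a b : (k != 0%R) || (l != 1%R) ->
  hform (delta_mx k 0 *m a)%R (delta_mx l 0 *m b)%R = 0%R.
Proof.
move=> kl; rewrite /hform mxE big1 // => i _; rewrite !mxE !big_ord1 !mxE.
by case/orP: kl => /negPf; rewrite eq_sym => ->; rewrite /= ?(mul0r, mulr0).
Qed.

Let prodgz_heis_row k (W : 'I_n -> heis int n) :
  (forall i, W i = Heis (delta_mx k i) 0%R) -> prodgz W =1 heis_row k.
Proof.
have k01 : (k != 0%R) || (k != 1%R) by case: k => [[|[]]].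
have row_comm a b : commute (heis_row k a) (heis_row k b).
  by rewrite /commute !heisM !hform_row // addrC.
move=> W_def; have WD : {morph heis_row k : a b / (a + b)%R >-> a * b}.
  by move=> a b; rewrite /heis_row heisM hform_row // mulmxDr.
have W_row i : W i = heis_row k (delta_mx 0 i)%R by rewrite W_def /heis_row mul_delta_mx.
apply: expmap_row_ext => // [|i]; last by rewrite prodgz_delta W_row.
by apply: prodgzD => i j; rewrite !W_row.
Qed.

Lemma heis_nf_heis v c : heis_nf heis_x heis_y heis_z v c = Heis v c :> heis int n.
Proof.
rewrite /heis_nf (prodgz_heis_row (k := 0%R)) // (prodgz_heis_row (k := 1%R)) //.
rewrite -heis_center_expgz; apply: heis_eq => /=; last first.
  by rewrite hform_row // hform0l !subr0 !add0r.
apply/matrixP => k i; rewrite !mxE !big_ord1 !mxE.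
by case: k => [[|[]]] //= ?; rewrite ?mul1r ?mul0r ?addr0 ?add0r; congr (v _ _); apply: val_inj.
Qed.

End HeisenbergNormalFormModel.

(** * Morphisms out of the balanced subgroup *)

Lemma dmx_form (R : comNzRingType) n (o i j : 'I_n) :
  (dmx o *m (dmx o)^T)%R i j = (dvec o i 0%R j - dvec o i 0%R o)%R :> R.
Proof.
transitivity ((dvec o i *m (dvec o j)^T)%R 0%R 0%R : R).
  by rewrite !mxE; apply: eq_bigr => k _; rewrite !mxE.
by rewrite mulmx_dvecT !mxE.
Qed.

Section TranslationProducts.
Local Open Scope ring_scope.
Variables (n : nat) (o : 'I_n) (G : groupType) (iota : {gmorphism 'S_n -> G}).
Variable X : 'I_n -> 'I_n -> G.
Hypothesis X_trans : translations iota X.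
Let XX i j : commute (X o i) (X o j) := commute_translation X_trans o i o j.

Lemma prodgz_dvec p q : prodgz (X o) (dvec p q) = X p q.
Proof.
rewrite prodgzD // (expmapN (prodgzD XX)) !prodgz_delta (translationV X_trans).
by rewrite (commute_translation X_trans) (translationD X_trans).
Qed.

Lemma prodgz_translationJ (s : 'S_n) (a : 'rV[int]_n) : a *m dmx o = a ->
  (prodgz (X o) a ^ iota s)%g = prodgz (X o) (a *m perm_mx s).
Proof.
move=> <-; move: a; apply: expmap_row_ext => [a b|a b|i].
- by rewrite mulmxDl prodgzD // conjMg.
- by rewrite !mulmxDl prodgzD.
- by rewrite -rowE rowK dvec_perm !prodgz_dvec (translationJ X_trans).
Qed.

End TranslationProducts.

Section BalancedMorphism.
Local Open Scope ring_scope.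
Variables (n : nat) (o : 'I_n) (G : groupType) (iota : {gmorphism 'S_n -> G}).
Variables (X Y : 'I_n -> 'I_n -> G) (z : G).
Hypothesis n_gt5 : (5 < n)%N.
Hypothesis X_trans : translations iota X.
Hypothesis Y_trans : translations iota Y.
Hypothesis XYz : forall p q r, uniq [:: p; q; r] -> [~ X p q, Y p r]%g = z.
Hypothesis zX : forall p q, commute z (X p q).
Hypothesis zY : forall p q, commute z (Y p q).
Hypothesis z_iota : forall s, commute z (iota s).
Let XX i j : commute (X o i) (X o j) := commute_translation X_trans o i o j.
Let YY i j : commute (Y o i) (Y o j) := commute_translation Y_trans o i o j.

Lemma translation_base_conj i j :
  (X o i ^ Y o j = X o i * expgz z ((dmx o *m (dmx o)^T) i j))%g.
Proof.
rewrite dmx_form !dvecE; have [->|io] := eqVneq i o.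
  by rewrite (translation1 X_trans) conj1g eqxx !subrr mulg1.
have [->|jo] := eqVneq j o.
  by rewrite (translation1 Y_trans) conjg1 [o == i]eq_sym (negPf io) eqxx subrr mulg1.
rewrite eqxx subr0 sub0r opprK.
have [->|ji] := eqVneq j i; last by rewrite conjg_commg XYz //; distinct.
have [k k_new] : exists k, k \notin [:: o; i].
  by apply: fresh_exists; rewrite card_ord (leq_trans _ n_gt5).
have Xik : (X i k ^ Y o i = X i k * z^-1)%g.
  apply: (conjg_inj (Y i o)); rewrite -conjgM (translationD Y_trans) (translation1 Y_trans).
  rewrite conjg1 conjMg conjVg (conjg_commg (X i k)) XYz; last by distinct.
  by rewrite (commute_conjgP _ _).1 ?mulgK.
have Xki : (X k i ^ Y o i = X k i * z)%g.
  rewrite -(translationV X_trans i k) conjVg Xik invgM invgK.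
  by apply: commuteV.
have Xok : (X o k ^ Y o i = X o k * z)%g by rewrite conjg_commg XYz //; distinct.
rewrite -(translationD X_trans o k i) conjMg Xki Xok -!mulgA (expgzD z 1 1).
by congr (_ * _)%g; rewrite mulgA zX -mulgA.
Qed.

Definition balanced_nf (m : pheis int n) : G :=
  (iota (pperm m) * heis_nf (X o) (Y o) z (hvec (pheisen m)) (hcen (pheisen m)))%g.

Let row_x_dmx (v : 'M[int]_(2, n)) : vsum v = 0 -> row_x v *m dmx o = row_x v.
Proof. by move=> v0; rewrite /row_x -row_mul mulmx_dmx. Qed.

Let row_y_dmx (v : 'M[int]_(2, n)) : vsum v = 0 -> row_y v *m dmx o = row_y v.
Proof. by move=> v0; rewrite /row_y -row_mul mulmx_dmx. Qed.

Lemma heis_nfJ (s : 'S_n) v c : vsum v = 0 ->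
  (heis_nf (X o) (Y o) z v c ^ iota s)%g = heis_nf (X o) (Y o) z (v *m perm_mx s) c.
Proof.
move=> v0; rewrite /heis_nf !conjMg (prodgz_translationJ X_trans _ (row_x_dmx v0)).
rewrite (prodgz_translationJ Y_trans _ (row_y_dmx v0)) /row_x /row_y !row_mul.
by congr (_ * _)%g; apply/commute_conjgP/commute_sym/commute_expgz/commute_sym.
Qed.

Lemma balanced_nfM : {in balanced &, {morph balanced_nf : m m' / (m * m')%g}}.
Proof.
move=> [s [v c]] [s' [v' c']] /eqP /= v0 /eqP /= v'0.
rewrite /balanced_nf /= mulgA_conjg heis_nfJ // -gmulfM; congr (_ * _)%g.
rewrite (heis_nfM XX YY _ _ translation_base_conj) // bform_dmx // vsum_perm //.
Qed.

Lemma balanced_nf_sym_in s : balanced_nf (sym_in s) = iota s.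
Proof. by rewrite /balanced_nf /= heis_nf0 mulg1. Qed.

Let row_delta_mul (k l : 'I_2) (d : 'rV[int]_n) :
  row l (delta_mx k 0 *m d) = if l == k then d else 0.
Proof.
apply/rowP => i; rewrite !mxE big_ord1 !mxE andbT.
by case: eqP; rewrite ?mul1r // mul0r mxE.
Qed.

Lemma balanced_nf_refl_x p q :
  balanced_nf (refl p q (delta_mx 0 0)) = reflection iota X p q.
Proof.
rewrite /balanced_nf /heis_nf /= /row_x /row_y !row_delta_mul /= !mxE mulr0 oppr0.
by rewrite prodgz0 !mulg1 (prodgz_dvec o X_trans).
Qed.

Lemma balanced_nf_refl_y p q :
  balanced_nf (refl p q (delta_mx 1 0)) = reflection iota Y p q.
Proof.
rewrite /balanced_nf /heis_nf /= /row_x /row_y !row_delta_mul /= !mxE mul0r oppr0.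
by rewrite prodgz0 mulg1 mul1g (prodgz_dvec o Y_trans).
Qed.

End BalancedMorphism.

Lemma balanced_morphism_exists n (G : groupType) (iota : {gmorphism 'S_n -> G}) X Y :
  5 < n -> translations iota X -> translations iota Y ->
  (forall p q r s, uniq [:: p; q; r; s] -> commute (X p q) (Y r s)) ->
  (forall p q r s, uniq [:: p; q; r; s] -> commute (X q p * X r s) (Y q r)) ->
  exists f : pheis int n -> G,
    [/\ {in balanced &, {morph f : m m' / m * m'}}, forall s, f (sym_in s) = iota s,
        forall p q, f (refl p q (delta_mx 0 0)%R) = reflection iota X p q &
        forall p q, f (refl p q (delta_mx 1 0)%R) = reflection iota Y p q].
Proof.
move=> n_gt5 X_trans Y_trans XY XXY; have n_card : 5 < #|'I_n| by rewrite card_ord.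
have [z [XYz zX zY z_iota]] := central_commg_exists n_card X_trans Y_trans XY XXY.
pose o := Ordinal (ltn_trans (isT : 0 < 5) n_gt5).
exists (balanced_nf o iota X Y z); split=> [|s|p q|p q].
- exact: balanced_nfM.
- exact: balanced_nf_sym_in.
- exact: balanced_nf_refl_x.
- exact: balanced_nf_refl_y.
Qed.

(** * The graph *)

Definition labels := iota 1 27.
Definition vertices := iota 1 18.
Definition ends (k : nat) : nat * nat := nth (0, 0) edges k.-1.
Definition edge_tperm (j : 'I_27) : 'S_18 := tperm (ep1 j) (ep2 j).

Lemma edgP (j : 'I_27) : exists2 k, k \in labels & j = edg k.
Proof. by exists j.+1; [rewrite mem_iota; have := ltn_ord j; lia | rewrite /edg inord_val]. Qed.

Lemma vtxP (p : 'I_18) : exists2 a, a \in vertices & p = vtx a.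
Proof. by exists p.+1; [rewrite mem_iota; have := ltn_ord p; lia | rewrite /vtx inord_val]. Qed.

Lemma val_edg k : k \in labels -> edg k = k.-1 :> nat.
Proof. by rewrite mem_iota => /andP[k0 k27]; rewrite inordK ?prednK. Qed.

Lemma vtx_inj : {in vertices &, injective vtx}.
Proof.
move=> a b; rewrite !mem_iota => /andP[a0 a18] /andP[b0 b18] /(congr1 val) /=.
by rewrite !inordK ?prednK // => ab; rewrite -(prednK a0) ab prednK.
Qed.

Lemma edg_inj : {in labels &, injective edg}.
Proof.
move=> k l kl ll /(congr1 val) /=; rewrite !val_edg //; move: kl ll.
by rewrite !mem_iota; lia.
Qed.

Lemma vtx_eq a b : a \in vertices -> b \in vertices -> (vtx a == vtx b) = (a == b).
Proof. exact: (inj_in_eq vtx_inj). Qed.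

Lemma uniq_vtx l : all [in vertices] l -> uniq (map vtx l) = uniq l.
Proof. by move=> /allP lv; apply: map_inj_in_uniq => a b /lv av /lv; apply: vtx_inj. Qed.

Lemma ep1_edg k : k \in labels -> ep1 (edg k) = vtx (ends k).1.
Proof. by move=> kl; rewrite /ep1 val_edg. Qed.

Lemma ep2_edg k : k \in labels -> ep2 (edg k) = vtx (ends k).2.
Proof. by move=> kl; rewrite /ep2 val_edg. Qed.

Lemma ends_vertices k : k \in labels -> ((ends k).1 \in vertices) * ((ends k).2 \in vertices).
Proof.
have /allP ends_ok : all (fun k => ((ends k).1 \in vertices) && ((ends k).2 \in vertices)) labels.
  by vm_compute.
by move=> /ends_ok /andP[-> ->].
Qed.

Lemma ep_neq j : ep1 j != ep2 j.
Proof.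
have /allP neq : all (fun k => (ends k).1 != (ends k).2) labels by vm_compute.
have [k kl ->] := edgP j; have e := ends_vertices kl.
by rewrite ep1_edg // ep2_edg // vtx_eq ?e // neq.
Qed.

Definition meets (k l : nat) : bool :=
  [|| (ends k).1 == (ends l).1, (ends k).1 == (ends l).2,
      (ends k).2 == (ends l).1 | (ends k).2 == (ends l).2].

Lemma share_edg k l : k \in labels -> l \in labels -> share (edg k) (edg l) = meets k l.
Proof.
move=> kl ll; have ek := ends_vertices kl; have el := ends_vertices ll.
by rewrite /share !ep1_edg // !ep2_edg // !vtx_eq ?ek ?el.
Qed.

Lemma ep_simple i j : i != j ->
  (ep1 j \notin [:: ep1 i; ep2 i]) || (ep2 j \notin [:: ep1 i; ep2 i]).
Proof.
have /allP simple : all (fun k => all (fun l => (k != l) ==>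
    ((ends l).1 \notin [:: (ends k).1; (ends k).2]) ||
    ((ends l).2 \notin [:: (ends k).1; (ends k).2])) labels) labels by vm_compute.
have [k kl ->] := edgP i; have [l ll ->] := edgP j => kl_neq.
have ek := ends_vertices kl; have el := ends_vertices ll.
rewrite !ep1_edg // !ep2_edg // !inE !vtx_eq ?ek ?el //.
have /allP/(_ l ll)/implyP := simple k kl; rewrite !inE; apply.
by apply: contraNneq kl_neq => ->.
Qed.

Definition swap (e : nat * nat) (a : nat) : nat :=
  if a == e.1 then e.2 else if a == e.2 then e.1 else a.

Lemma tperm_vtx a b c : a \in vertices -> b \in vertices -> c \in vertices ->
  tperm (vtx a) (vtx b) (vtx c) = vtx (swap (a, b) c).
Proof.
move=> av bv cv; rewrite /swap /=; have [->|ca] := eqVneq c a; first by rewrite tpermL.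
have [->|cb] := eqVneq c b; first by rewrite tpermR.
by rewrite tpermD // vtx_eq // eq_sym.
Qed.

Lemma edge_tperm_edg k : k \in labels ->
  edge_tperm (edg k) = tperm (vtx (ends k).1) (vtx (ends k).2).
Proof. by move=> kl; rewrite /edge_tperm ep1_edg // ep2_edg. Qed.

Fixpoint grows_from (T : eqType) (reached : seq T) (es : seq (T * T)) : bool :=
  if es is e :: es' then (e.1 \in reached) && grows_from (e.2 :: reached) es' else true.

Lemma grows_from_ind (T : eqType) (Q : T -> T -> Prop) (r : T) es :
  (forall a, Q a a) -> (forall a b, Q a b -> Q b a) ->
  (forall a b c, Q a b -> Q b c -> Q a c) ->
  grows_from [:: r] es -> (forall e, e \in es -> Q e.1 e.2) ->
  {in r :: map snd es &, forall a b, Q a b}.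
Proof.
move=> Qr Qs Qt; suff Qtree reached : grows_from reached es ->
    (forall a, a \in reached -> Q r a) -> (forall e, e \in es -> Q e.1 e.2) ->
    forall a, a \in reached ++ map snd es -> Q r a.
  move=> gr Qe a b ar br; have Qra := Qtree _ gr _ Qe.
  by apply: Qt (Qs _ _ (Qra _ a _)) (Qra _ b _) => // c; rewrite inE => /eqP ->.
elim: es reached => [|e es IH] reached /=; first by rewrite cats0.
move=> /andP[e1 gr] Qreached Qe a ain; apply: (IH _ gr) => [b|e' e'in|].
- rewrite inE => /orP[/eqP ->|]; last exact: Qreached.
  by apply: Qt (Qreached _ e1) (Qe _ _); rewrite mem_head.
- by apply: Qe; rewrite inE e'in orbT.
- by move: ain; rewrite !(mem_cat, inE) orbCA orbA.
Qed.

Lemma edge_tpermJ k a b : k \in labels -> a \in vertices -> b \in vertices ->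
  tperm (vtx a) (vtx b) ^ edge_tperm (edg k) =
  tperm (vtx (swap (ends k) a)) (vtx (swap (ends k) b)).
Proof.
move=> kl av bv; have [e1 e2] := ends_vertices kl.
by rewrite tpermJ edge_tperm_edg // !tperm_vtx // -surjective_pairing.
Qed.

Definition joins (k : nat) (e : nat * nat) : bool :=
  (k \in labels) && ((ends k == e) || (ends k == (e.2, e.1))).

Definition spanning (ks : seq nat) (r : nat) (es : seq (nat * nat)) : bool :=
  [&& grows_from [:: r] es, all [in r :: map snd es] vertices &
      all (fun e => has (joins^~ e) ks) es].

Lemma spanning_ind ks r es (Q : 'I_18 -> 'I_18 -> Prop) : spanning ks r es ->
  (forall p, Q p p) -> (forall p q, Q p q -> Q q p) ->
  (forall p q s, Q p q -> Q q s -> Q p s) ->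
  {in ks, forall k, Q (ep1 (edg k)) (ep2 (edg k))} -> forall p q, Q p q.
Proof.
move=> /and3P[gr /allP cover /allP es_ks] Qr Qs Qt Qks p q.
have [a /cover ar ->] := vtxP p; have [b /cover br ->] := vtxP q.
apply: (grows_from_ind (Q := fun a b => Q (vtx a) (vtx b)) _ _ _ gr _ ar br) => //.
- by move=> c d; apply: Qs.
- by move=> c d e; apply: Qt.
move=> e /es_ks /hasP[k /Qks Qk /andP[kl]]; rewrite ep1_edg // ep2_edg // in Qk.
by case/orP=> /eqP ek; rewrite ek in Qk => //; apply: Qs.
Qed.

Lemma spanning_perm_ind ks r es (P : 'S_18 -> Prop) : spanning ks r es -> P 1 ->
  (forall s t, P s -> P t -> P (s * t)) ->
  {in ks, forall k, P (edge_tperm (edg k))} -> forall s, P s.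
Proof.
move=> span P1 PM Pks s; apply: (@perm_on_ind _ setT P) => // [t p q _ _ Pt|]; last first.
  by apply/subsetP => p; rewrite inE.
apply: (PM) => //; apply: (spanning_ind (Q := fun p q => P (tperm p q)) span) => //.
- by move=> p'; rewrite tperm1.
- by move=> p' q'; rewrite tpermC.
- exact: tperm_trans P1 PM.
Qed.

(** * The relations of [C] *)

Section Relations.
Variables (G : groupType) (u : 'I_27 -> G).
Hypothesis u_rel : @CRel (agroup_of G) u.
Local Notation U k := (u (edg k)).

Lemma edge_gen2 j : u j * u j = 1.
Proof. by case: u_rel => sq _ _ _; apply: sq. Qed.

Lemma commute_edge_gen k l : k \in labels -> l \in labels -> ~~ meets k l -> commute (U k) (U l).
Proof. by case: u_rel => _ comm _ _ kl ll ns; apply: comm; rewrite share_edg. Qed.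

Lemma edge_genJ k l : k \in labels -> l \in labels -> k != l -> meets k l -> U k ^ U l = U l ^ U k.
Proof.
case: u_rel => _ _ braid _ kl ll kl_neq kl_meet; rewrite !conjg_involution ?edge_gen2 //.
by apply/esym/braid; [rewrite (inj_in_eq edg_inj) | rewrite share_edg].
Qed.

Lemma hex_relP h : @hex_rel (agroup_of G) u h <->
  U (nth 0 h 0) ^ (U (nth 0 h 1) * U (nth 0 h 2) * U (nth 0 h 3) * U (nth 0 h 4)) =
  U (nth 0 h 5).
Proof.
have conj_word (a b c d e f : G) :
    a * b * c * d * e = b * c * d * e * f <-> a ^ (b * c * d * e) = f.
  set w := b * c * d * e; have -> : a * b * c * d * e = a * w by rewrite /w !mulgA.
  by rewrite conjgE; split=> [->|<-]; [exact: mulKg | rewrite mulVKg].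
exact: conj_word.
Qed.

Definition rotatable (h : seq nat) : bool :=
  [&& size h == 6, all [in labels] h, nth 0 h 0 != nth 0 h 1, meets (nth 0 h 0) (nth 0 h 1) &
      all (fun i => ~~ meets (nth 0 h 0) (nth 0 h i)) [:: 2; 3; 4]].

Lemma hex_rel_rot h : rotatable h -> @hex_rel (agroup_of G) u h ->
  @hex_rel (agroup_of G) u (rot 1 h).
Proof.
case: h => [|a [|b [|c [|d [|e [|f []]]]]]] // /and5P[_ hl ab ab_meet /and4P[ac ad ae _]].
case/and5P: hl => /= al bl cl dl /andP[el _] in ab ab_meet ac ad ae.
move=> /hex_relP /= f_def; apply/hex_relP; rewrite /= -f_def.
have a_cde : commute (U a) (U c * U d * U e) by do !apply: commuteM; apply: commute_edge_gen.
set w := U b * U c * U d * U e.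
have bw : U b * w = U c * U d * U e by rewrite /w !mulgA edge_gen2 mul1g.
rewrite -bw -mulgA (conjgE (U a)) mulVKg conjgM (commute_conjgP (U b) (U b)).1 //.
by rewrite conjgM -(edge_genJ al bl) // -conjgM bw; apply/commute_conjgP.
Qed.

Lemma hexagon_rot n h : h \in hexagons -> n < 6 -> @hex_rel (agroup_of G) u (rot n h).
Proof.
have /allP rot_ok : all (fun h => all (fun n => rotatable (rot n h)) (iota 0 6)) hexagons.
  by vm_compute.
move=> hh; have /allP h_ok := rot_ok h hh.
have h6 : size h = 6 by have /and5P[/eqP] := h_ok 0 isT; rewrite size_rot.
elim: n => [|n IH] n6; first by rewrite rot0; case: u_rel => _ _ _ hexs; apply: hexs.
rewrite rotS ?h6; last exact: ltnW.
by apply: hex_rel_rot; [apply: h_ok; rewrite mem_iota; lia | apply/IH/ltnW].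
Qed.

Lemma hexagon_rotE n h : h \in hexagons -> n < 6 -> let h' := rot n h in
  U (nth 0 h' 5) =
    (((U (nth 0 h' 0) ^ U (nth 0 h' 1)) ^ U (nth 0 h' 2)) ^ U (nth 0 h' 3)) ^ U (nth 0 h' 4).
Proof. by move=> hh n6 h'; rewrite -!conjgM !mulgA; apply/esym/hex_relP/hexagon_rot. Qed.

Lemma commute_hexagon n h k : h \in hexagons -> n < 6 -> let h' := rot n h in
  k \in labels ->
  all (fun i => (nth 0 h' i \in labels) && ~~ meets k (nth 0 h' i)) [:: 2; 3; 4; 5] ->
  commute (U k) (U (nth 0 h' 0) ^ U (nth 0 h' 1)).
Proof.
move=> hh n6 h' kl /= /and5P[/andP[l2 k2] /andP[l3 k3] /andP[l4 k4] /andP[l5 k5] _].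
have commute_conjK (a b c : G) : commute a c -> commute a (b ^ c) -> commute a b.
  move=> ac abc; rewrite -(conjgK c b) -[a](conjgK c) [a ^ c](commute_conjgP _ _).1 //.
  exact: commute_conj.
apply: (commute_conjK _ _ (U (nth 0 h' 2))); first exact: commute_edge_gen.
apply: (commute_conjK _ _ (U (nth 0 h' 3))); first exact: commute_edge_gen.
apply: (commute_conjK _ _ (U (nth 0 h' 4))); first exact: commute_edge_gen.
by rewrite -hexagon_rotE //; apply: commute_edge_gen.
Qed.

End Relations.

Fixpoint hexagon_chain (known ks : seq nat) : bool :=
  if ks is k :: ks' then
    has (fun h => (k \in h) && all (fun l => (l == k) || (l \in known)) h) hexagons &&
    hexagon_chain (k :: known) ks'
  else true.

Section Rigidity.
Variables (G : groupType) (u v : 'I_27 -> G).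
Hypothesis u_rel : @CRel (agroup_of G) u.
Hypothesis v_rel : @CRel (agroup_of G) v.

Lemma hexagon_rigid h k : h \in hexagons -> k \in h ->
  {in h, forall l, l != k -> u (edg l) = v (edg l)} -> u (edg k) = v (edg k).
Proof.
have /allP rot_last : all (fun h => all (fun k => has (fun n =>
    [&& n < 6, nth 0 (rot n h) 5 == k &
        all (fun i => (nth 0 (rot n h) i \in h) && (nth 0 (rot n h) i != k)) (iota 0 5)])
  (iota 0 6)) h) hexagons by vm_compute.
move=> hh kh uv; have /allP/(_ k kh)/hasP[n _ /and3P[n6 /eqP k_last /allP h_neq]] := rot_last h hh.
have uv_rot i : i \in iota 0 5 -> u (edg (nth 0 (rot n h) i)) = v (edg (nth 0 (rot n h) i)).
  by move=> /h_neq /andP[hi ki]; apply: uv hi ki.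
by rewrite -k_last (hexagon_rotE u_rel) // (hexagon_rotE v_rel) // !uv_rot.
Qed.

Lemma hexagon_chain_rigid known ks : hexagon_chain known ks ->
  {in known, forall k, u (edg k) = v (edg k)} ->
  {in known ++ ks, forall k, u (edg k) = v (edg k)}.
Proof.
elim: ks known => [|k ks IH] known; first by rewrite cats0.
move=> /andP[/hasP[h hh /andP[kh /allP h_known]] chain] uv l l_in.
apply: (IH (k :: known) chain) => [l'|]; last by move: l_in; rewrite inE !mem_cat inE orbCA.
rewrite inE => /orP[/eqP ->|]; last exact: uv.
by apply: hexagon_rigid kh _ => // i /h_known; case: eqP => //= _ ik _; apply: uv.
Qed.

End Rigidity.

Section Transfer.
Variables G K : groupType.

Lemma CRel_morph_in (D : {pred G}) (f : G -> K) u :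
  {in D &, forall a b, a * b \in D} -> {in D &, {morph f : a b / a * b}} ->
  (forall j, u j \in D) -> @CRel (agroup_of G) u -> @CRel (agroup_of K) (fun j => f (u j)).
Proof.
move=> DM fM uD [sq comm braid hexs]; have f1 : f 1 = 1.
  have D1 : 1 \in D by have := DM _ _ (uD (edg 1)) (uD (edg 1)); rewrite [_ * _]sq.
  by apply: (mulgI (f 1)); rewrite -fM // !mulg1.
have fM3 i j k : f (u i) * f (u j) * f (u k) = f (u i * u j * u k).
  by rewrite !fM ?DM.
have fM5 i j k l m : f (u i) * f (u j) * f (u k) * f (u l) * f (u m) =
    f (u i * u j * u k * u l * u m) by rewrite !fM ?DM.
split=> [j|i j ij|i j ij ij'|h hh].
- by rewrite -[LHS]fM // [_ * _]sq.
- by rewrite -[LHS]fM // -[RHS]fM //; congr f; apply: comm.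
- by rewrite [LHS]fM3 [RHS]fM3; congr f; apply: braid.
- by rewrite /hex_rel [LHS]fM5 [RHS]fM5; congr f; apply: hexs.
Qed.

Lemma CRel_local (t : 'I_27 -> G) (v : 'I_27 -> K) : @CRel (agroup_of G) t ->
  (forall i j, exists f : {gmorphism G -> K}, f (t i) = v i /\ f (t j) = v j) ->
  (forall h, h \in hexagons -> exists f : {gmorphism G -> K},
     forall k, k \in h -> f (t (edg k)) = v (edg k)) ->
  @CRel (agroup_of K) v.
Proof.
move=> t_rel pairs hexs.
have t_im (f : {gmorphism G -> K}) : @CRel (agroup_of K) (fun j => f (t j)).
  by apply: (@CRel_morph_in predT f) t_rel => // a b _ _; apply: gmulfM.
split=> [j|i j ij|i j ij ij'|h hh].
- by have [f [<- _]] := pairs j j; have [sq _ _ _] := t_im f; apply: sq.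
- by have [f [<- <-]] := pairs i j; have [_ comm _ _] := t_im f; apply: comm.
- by have [f [<- <-]] := pairs i j; have [_ _ braid _] := t_im f; apply: braid.
have /allP hex6 : all (fun h => size h == 6) hexagons by [].
have [f f_h] := hexs h hh; have [_ _ _ /(_ h hh)] := t_im f; rewrite /hex_rel.
by rewrite !f_h // mem_nth // (eqP (hex6 h hh)).
Qed.

End Transfer.

(** * Reflections of the model satisfying the relations *)

Lemma edge_tperm_CRel : @CRel (agroup_of 'S_18) edge_tperm.
Proof.
split=> [j|i j|i j ij|h hh].
- exact: tperm2.
- by rewrite /share !negb_or => /and4P[*]; apply: commute_tperm.
- by move=> ij_share; apply: tperm_braid_meet (ep_simple ij); rewrite ?ep_neq.
have /allP/(_ h hh)/allP h_labels : all (all [in labels]) hexagons by vm_compute.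
have /allP/(_ h hh)/eqP h6 : all (fun h => size h == 6) hexagons by [].
apply/hex_relP; rewrite (edge_tperm_edg (h_labels _ (mem_nth 0 (_ : 0 < size h)))) ?h6 //.
rewrite (edge_tperm_edg (h_labels _ (mem_nth 0 (_ : 5 < size h)))) ?h6 // !conjgM.
move: hh; rewrite !inE; do ?[case/orP]; move=> /eqP ->; rewrite /= !edge_tpermJ //=;
  exact: tpermC.
Qed.

Section ModelGenerators.
Local Open Scope ring_scope.

(* Displacement in the universal cover of the torus along each edge, from its
   first to its second endpoint; it vanishes along the path [hamiltonian_path] below. *)
Definition displacements : seq (int * int) :=
  [:: (0, 0); (0, 0); (0, 0); (-1, 0); (0, 0); (0, 0); (0, 0); (0, 1); (0, 0);
      (0, 0); (0, 0); (0, 0); (1, 0); (0, 0); (-1, 1); (0, 0); (0, 0); (0, 0);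
      (0, 0); (0, 0); (0, 0); (0, 0); (0, 0); (0, 1); (0, 0); (0, -1); (0, 0)].

Definition pair_col (w : int * int) : 'cV[int]_2 := \col_i (if i == 0 then w.1 else w.2).

Lemma pair_colB : {morph pair_col : w w' / w - w'}.
Proof. by move=> w w'; apply/colP => i; rewrite !mxE; case: ifP. Qed.

Lemma pair_colN : {morph pair_col : w / - w}.
Proof. by move=> w; apply/colP => i; rewrite !mxE; case: ifP. Qed.

Lemma pair_col_x : pair_col (1, 0) = delta_mx 0 0.
Proof. by apply/colP => -[[|[]] //= i]; rewrite !mxE. Qed.

Lemma pair_col_y : pair_col (0, 1) = delta_mx 1 0.
Proof. by apply/colP => -[[|[]] //= i]; rewrite !mxE. Qed.

Definition disp (k : nat) : int * int := nth (0, 0) displacements k.-1.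

Definition sgen (j : 'I_27) : pheis int 18 := refl (ep1 j) (ep2 j) (pair_col (disp j.+1)).

Lemma sgen_edg k : k \in labels ->
  sgen (edg k) = refl (vtx (ends k).1) (vtx (ends k).2) (pair_col (disp k)).
Proof.
move=> kl; have := kl; rewrite mem_iota => /andP[k0 _].
by rewrite /sgen ep1_edg // ep2_edg // val_edg // prednK.
Qed.

(* A potential is encoded by pairs of a list of vertices and its value there;
   it vanishes on the vertices not listed. *)
Definition potential (phi : seq (seq nat * (int * int))) (a : nat) : int * int :=
  (nth ([::], (0, 0)) phi (find (fun c => a \in c.1) phi)).2.

Definition potential_mx phi : 'M[int]_(2, 18) :=
  \matrix_(i, p) pair_col (potential phi p.+1) i 0.

Definition is_potential phi (ks : seq nat) : bool :=
  all (fun k => disp k == potential phi (ends k).2 - potential phi (ends k).1) ks.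

Lemma sgen_potential phi ks : all [in labels] ks -> is_potential phi ks ->
  {in ks, forall k, gauged (potential_mx phi) (edge_tperm (edg k)) = sgen (edg k)}.
Proof.
move=> /allP ks_labels /allP phi_ks k kin; have kl := ks_labels k kin.
have col_vtx a : a \in vertices -> col (vtx a) (potential_mx phi) = pair_col (potential phi a).
  rewrite mem_iota => /andP[a0 a18]; apply/colP => i; rewrite mxE mxE inordK ?prednK //.
have [e1 e2] := ends_vertices kl; rewrite sgen_edg // edge_tperm_edg //.
by apply: gauged_tperm; rewrite !col_vtx // -pair_colB -(eqP (phi_ks k kin)).
Qed.

Lemma sgen_CRel : @CRel (agroup_of (pheis int 18)) sgen.
Proof.
apply: CRel_local edge_tperm_CRel _ _ => [i j|h hh].
  have [->|ij] := eqVneq i j.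
    have [phi phi_j] := potential_exists (pair_col (disp j.+1)) (ep_neq j).
    by exists (gauged phi); rewrite (gauged_tperm phi_j).
  have [phi [phi_i phi_j]] := pair_potential_exists (pair_col (disp i.+1))
    (pair_col (disp j.+1)) (ep_neq i) (ep_neq j) (ep_simple ij).
  by exists (gauged phi); rewrite (gauged_tperm phi_i) (gauged_tperm phi_j).
suff [phi phi_h] : exists phi, is_potential phi h.
  exists (gauged (potential_mx phi)); apply: sgen_potential => //.
  by have /allP : all (all [in labels]) hexagons by []; apply.
move: hh; rewrite !inE => /or4P[/eqP->|/eqP->|/eqP->|].
- by exists [:: ([:: 3; 2; 7]%N, (-1, 0))].
- by exists [::].
- by exists [::].
case/or4P=> [/eqP->|/eqP->|/eqP->|/or3P[/eqP->|/eqP->|/eqP->]].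
- by exists [:: ([:: 12; 10]%N, (-1, 1)); ([:: 3]%N, (-1, 0))].
- by exists [:: ([:: 10; 18]%N, (0, 1))].
- by exists [::].
- by exists [:: ([:: 12; 11; 7]%N, (-1, 1)); ([:: 15]%N, (0, 1))].
- by exists [::].
- by exists [:: ([:: 18; 17; 13; 15]%N, (0, 1))].
Qed.

Lemma balanced_sgen j : sgen j \in balanced.
Proof. exact: balanced_refl. Qed.

Definition T0_labels : seq nat :=
  [:: 5; 6; 8; 9; 11; 12; 14; 16; 18; 19; 20; 21; 22; 24; 25; 26; 27]%N.

Definition T0_potential : 'M[int]_(2, 18) :=
  potential_mx [:: ([:: 1; 2; 3; 4; 5; 6; 8; 14; 16]%N, (0, -1))].

Lemma sgen_T0 j : j \in T0 -> gauged T0_potential (edge_tperm j) = sgen j.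
Proof. by case/mapP=> k kT0 ->; apply: sgen_potential kT0. Qed.

Lemma T0_perm_ind (P : 'S_18 -> Prop) : P 1%g -> (forall s t, P s -> P t -> P (s * t)%g) ->
  {in T0, forall j, P (edge_tperm j)} -> forall s, P s.
Proof.
pose es := [:: (1, 5); (5, 8); (8, 16); (16, 14); (14, 18); (18, 10); (10, 3); (3, 2);
  (10, 12); (12, 11); (11, 7); (14, 6); (6, 4); (16, 15); (15, 13); (18, 17); (17, 9)]%N.
have T0_spanning : spanning T0_labels 1%N es by vm_compute.
move=> P1 PM PT0; apply: (spanning_perm_ind T0_spanning) => // k kT0.
exact/PT0/map_f.
Qed.

End ModelGenerators.

(** * Reconstruction of the model from the relations *)

Definition hamiltonian_path := [:: 3; 2; 7; 11; 12; 10; 18; 17; 9; 4; 6; 14; 16; 8; 5; 1; 13; 15]%N.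
Definition path_edges := [:: 6; 1; 14; 21; 19; 20; 27; 18; 3; 9; 12; 25; 16; 11; 5; 2; 22]%N.

Lemma hamiltonian_path_inj : injective (fun i : 'I_18 => vtx (nth 0 hamiltonian_path i)).
Proof.
have /(all_nthP 0) path_vertices : all [in vertices] hamiltonian_path by [].
move=> i j /eqP; rewrite vtx_eq ?path_vertices // nth_uniq // => /eqP /val_inj //.
Qed.

Lemma sgen_path_edge k : k \in path_edges -> sgen (edg k) = sym_in (edge_tperm (edg k)).
Proof.
have /allP disp0 : all (fun k => (k \in labels) && (disp k == 0%R)) path_edges by vm_compute.
move=> /disp0 /andP[kl /eqP k0]; rewrite sgen_edg // k0 edge_tperm_edg // -refl0.
by congr refl; apply/colP => i; rewrite !mxE; case: ifP.
Qed.

Lemma path_edges_perm_ind (P : 'S_18 -> Prop) : P 1 -> (forall s t, P s -> P t -> P (s * t)) ->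
  {in path_edges, forall k, P (edge_tperm (edg k))} -> forall s, P s.
Proof.
have span : spanning path_edges 3 (zip hamiltonian_path (behead hamiltonian_path)) by vm_compute.
exact: spanning_perm_ind span.
Qed.

Section Reconstruction.
Variables (G : groupType) (u : 'I_27 -> G).
Hypothesis u_rel : @CRel (agroup_of G) u.
Local Notation U k := (u (edg k)).

Lemma path_edges_coxeter : coxeter_rel 17 (fun i => U (nth 0 path_edges i)).
Proof.
have /(all_nthP 0) hl : all [in labels] path_edges by vm_compute.
split=> [i _|i j /andP[ij j17]|i i17]; first exact: edge_gen2.
  have /allP/(_ j) : all (fun j => all (fun i => (i.+1 < j) ==>
      ~~ meets (nth 0 path_edges i) (nth 0 path_edges j)) (iota 0 17)) (iota 0 17) by vm_compute.
  have [iin jin] : i \in iota 0 17 /\ j \in iota 0 17 by rewrite !mem_iota; lia.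
  move=> /(_ jin)/allP/(_ i iin); rewrite ij => nmeet.
  by apply: commute_edge_gen; rewrite ?hl //=; lia.
have /allP/(_ i) : all (fun i => (i.+1 < 17) ==> (nth 0 path_edges i != nth 0 path_edges i.+1) &&
    meets (nth 0 path_edges i) (nth 0 path_edges i.+1)) (iota 0 17) by vm_compute.
have iin : i \in iota 0 17 by rewrite mem_iota; lia.
rewrite iin i17 => /(_ isT) /andP[neq meet].
by rewrite -!conjg_involution ?edge_gen2 //; apply/esym/edge_genJ; rewrite ?hl // ltnW.
Qed.

Lemma path_morphism_exists : exists rho : {gmorphism 'S_18 -> G},
  {in path_edges, forall k, rho (edge_tperm (edg k)) = U k}.
Proof.
have [rho rho_path] := coxeter_path_morphism path_edges_coxeter hamiltonian_path_inj.
exists rho => k kin; have i17 : index k path_edges < 17 by rewrite index_mem.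
have /allP/(_ (index k path_edges)) : all (fun i => joins (nth 0 path_edges i)
    (nth 0 hamiltonian_path i, nth 0 hamiltonian_path i.+1)) (iota 0 17) by vm_compute.
rewrite mem_iota i17 nth_index // => /(_ isT) /andP[kl ends_k].
rewrite -[in RHS](nth_index 0 kin) -rho_path // !inordK ?edge_tperm_edg //; last by lia.
  by case/orP: ends_k => /eqP -> //=; rewrite tpermC.
Qed.

Section WithPathMorphism.
Variable rho : {gmorphism 'S_18 -> G}.
Hypothesis rho_path_edges : {in path_edges, forall k, rho (edge_tperm (edg k)) = U k}.
Local Notation t a b := (tau rho (vtx a) (vtx b)).

Lemma tau_path_edge k e : k \in path_edges -> joins k e -> t e.1 e.2 = U k.
Proof.
move=> kin /andP[kl ends_k]; rewrite -rho_path_edges // edge_tperm_edg //.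
by case/orP: ends_k => /eqP -> //=; rewrite tauC.
Qed.

(* An edge [w] gives a translation family as soon as [U w] commutes with [t a b]
   for one pair [e0 = (a, b)] which, together with the edges of the path that do
   not meet [w], forms a tree [es] on the vertices off [w]. *)
Definition generates_translations (w r1 r2 r : nat) (e0 : nat * nat) (es : seq (nat * nat)) :=
  let p := (ends w).1 in let q := (ends w).2 in
  [&& w \in labels, uniq [:: p; q; r1] && uniq [:: p; q; r2],
      (r1 \in vertices) && (r2 \in vertices),
      grows_from [:: r] es && all (fun a => a \in [:: p, q, r & map snd es]) vertices &
      [&& all (fun e => (e == e0) || has (fun k => joins k e && ~~ meets w k) path_edges) es,
          has (fun k => [&& joins k (q, r1), w != k & meets k w]) path_edges &
          has (fun k => [&& joins k (p, r2), w != k & meets k w]) path_edges]].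

Lemma edge_translations w r1 r2 r e0 es : generates_translations w r1 r2 r e0 es ->
  commute (U w) (t e0.1 e0.2) ->
  exists2 X, translations rho X & reflection rho X (vtx (ends w).1) (vtx (ends w).2) = U w.
Proof.
case/and5P=> wl /andP[u1 u2] /andP[r1v r2v] /andP[gr /allP cover].
case/and3P=> /allP es_ok w_right w_left w_e0; have [pv qv] := ends_vertices wl.
set p := (ends w).1 in pv *; set q := (ends w).2 in qv *.
have braid c d : has (fun k => [&& joins k (c, d), w != k & meets k w]) path_edges ->
    t c d ^ U w = U w ^ t c d.
  case/hasP=> k kin /and3P[kcd wk kw]; rewrite (tau_path_edge kin kcd).
  by apply: edge_genJ; rewrite 1?eq_sym //; case/andP: kcd.
apply: (translations_exist (r1 := vtx r1) (r2 := vtx r2)); rewrite ?edge_gen2 ?braid //.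
- by rewrite -[[:: _; _; _]]/(map vtx [:: p; q; r1]) uniq_vtx //= pv qv r1v.
- by rewrite -[[:: _; _; _]]/(map vtx [:: p; q; r2]) uniq_vtx //= pv qv r2v.
have off_w a : a \in vertices -> vtx a \notin [:: vtx p; vtx q] -> a \in r :: map snd es.
  by move=> av; rewrite !inE !vtx_eq // => /negPf off; have := cover a av; rewrite !inE orbA off.
move=> a' b'; have [a av ->] := vtxP a'; have [b bv ->] := vtxP b' => /off_w ar /off_w br.
apply: (grows_from_ind (Q := fun a b => commute (U w) (t a b)) _ _ _ gr _ (ar av) (br bv)).
- by move=> c; rewrite tau1; apply: commute1.
- by move=> c d; rewrite tauC.
- by move=> c d e; apply: commute_tau_trans.
move=> e /es_ok /orP[/eqP -> //|/hasP[k kin /andP[ke wk]]].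
by rewrite (tau_path_edge kin ke); apply: commute_edge_gen => //; case/andP: ke.
Qed.

Lemma translations13_exist :
  exists2 X, translations rho X & reflection rho X (vtx 7) (vtx 15) = U 13.
Proof.
apply: (@edge_translations 13 13 2 3 (2, 11) [:: (3, 2); (2, 11); (11, 12); (12, 10);
  (10, 18); (18, 17); (17, 9); (9, 4); (4, 6); (6, 14); (14, 16); (16, 8); (8, 5); (5, 1);
  (1, 13)]%N); first by vm_compute.
have := commute_hexagon u_rel (h := [:: 1; 7; 9; 3; 17; 14]%N) (n := 5) (k := 13) isT isT isT isT.
rewrite /= -(tau_path_edge (k := 14) (e := (7, 11))) //.
rewrite -(tau_path_edge (k := 1%N) (e := (2, 7))) //.
by rewrite tauJ !tperm_vtx.
Qed.

Lemma translations8_exist :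
  exists2 Y, translations rho Y & reflection rho Y (vtx 3) (vtx 10) = U 8.
Proof.
apply: (@edge_translations 8 12 2 2 (12, 18) [:: (2, 7); (7, 11); (11, 12); (12, 18);
  (18, 17); (17, 9); (9, 4); (4, 6); (6, 14); (14, 16); (16, 8); (8, 5); (5, 1); (1, 13);
  (13, 15)]%N); first by vm_compute.
have := commute_hexagon u_rel (h := [:: 21; 17; 18; 27; 20; 19]%N) (n := 4) (k := 8)
  isT isT isT isT.
rewrite /= -(tau_path_edge (k := 20) (e := (10, 18))) //.
rewrite -(tau_path_edge (k := 19) (e := (10, 12))) //.
by rewrite tauJ !tperm_vtx.
Qed.

Section AgreeingMorphism.
Variable f : pheis int 18 -> G.
Hypothesis fM : {in balanced &, {morph f : m m' / m * m'}}.
Hypothesis f_sym : forall s, f (sym_in s) = rho s.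

Lemma sgen_chain known ks : hexagon_chain (known ++ path_edges) ks ->
  {in known, forall k, f (sgen (edg k)) = U k} ->
  {in (known ++ path_edges) ++ ks, forall k, f (sgen (edg k)) = U k}.
Proof.
move=> chain f_known.
have f_rel : @CRel (agroup_of G) (fun j => f (sgen j)).
  exact: CRel_morph_in (@balancedM _ _) fM balanced_sgen sgen_CRel.
apply: (hexagon_chain_rigid f_rel u_rel chain) => k; rewrite mem_cat => /orP[/f_known //|kin].
by rewrite sgen_path_edge // f_sym rho_path_edges.
Qed.

End AgreeingMorphism.

Section WithTranslations.
Variables X Y : 'I_18 -> 'I_18 -> G.
Hypothesis X_trans : translations rho X.
Hypothesis Y_trans : translations rho Y.
Hypothesis X13 : reflection rho X (vtx 7) (vtx 15) = U 13.
Hypothesis Y8 : reflection rho Y (vtx 3) (vtx 10) = U 8.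

Lemma edge4_reflection : U 4 = reflection rho X (vtx 3) (vtx 1).
Proof.
have [|||f [fM f_sym f_x _]] :=
  balanced_morphism_exists (n := 18) _ X_trans (translations_trivial rho) => // [*|*|];
  try exact: commute1.
have <- : f (sgen (edg 4)) = U 4.
  apply: (sgen_chain fM f_sym (known := [:: 13]) (ks := [:: 4])) => //.
  by move=> k /[!inE] /eqP ->; rewrite sgen_edg // pair_col_x f_x.
by rewrite sgen_edg // reflC -pair_colN (_ : (- disp 4)%R = (1, 0)%R) // pair_col_x f_x.
Qed.

Lemma edge26_reflection : U 26 = reflection rho Y (vtx 16) (vtx 15).
Proof.
have [|||f [fM f_sym _ f_y]] :=
  balanced_morphism_exists (n := 18) _ (translations_trivial rho) Y_trans => // [*|*|].
- exact/commute_sym/commute1.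
- by rewrite mulg1; apply/commute_sym/commute1.
have <- : f (sgen (edg 26)) = U 26.
  apply: (sgen_chain fM f_sym (known := [:: 8]) (ks := [:: 10; 17; 7; 23; 24; 26])).
  - by vm_compute.
  - by move=> k /[!inE] /eqP ->; rewrite sgen_edg // pair_col_y f_y.
  - by [].
by rewrite sgen_edg // reflC -pair_colN (_ : (- disp 26)%R = (0, 1)%R) // pair_col_y f_y.
Qed.

Lemma edge15_hexagon4 :
  U 15 = reflection rho Y (vtx 3) (vtx 12) ^ reflection rho X (vtx 3) (vtx 8).
Proof.
rewrite (hexagon_rotE u_rel (n := 2) (h := [:: 11; 15; 19; 8; 4; 5])) //=.
rewrite -(tau_path_edge (k := 19) (e := (10, 12))) // -(tau_path_edge (k := 5) (e := (1, 5)%N)) //.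
rewrite -(tau_path_edge (k := 11) (e := (5, 8))) // -Y8 edge4_reflection.
rewrite /= (tau_reflectionR Y_trans); last first.
  by rewrite -[[:: _; _; _]]/(map vtx [:: 3; 10; 12]) uniq_vtx.
by rewrite !(reflection_conjJ X_trans Y_trans) !tperm_vtx.
Qed.

Lemma edge15_hexagon7 :
  U 15 = reflection rho Y (vtx 8) (vtx 15) ^ reflection rho X (vtx 12) (vtx 15).
Proof.
rewrite (hexagon_rotE u_rel (n := 5) (h := [:: 26; 13; 14; 21; 15; 16])) //=.
rewrite -(tau_path_edge (k := 16) (e := (16, 8))) // -(tau_path_edge (k := 14) (e := (7, 11))) //.
rewrite -(tau_path_edge (k := 21) (e := (11, 12))) // -X13 edge26_reflection.
rewrite /= (tau_reflectionL Y_trans); last first.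
  by rewrite -[[:: _; _; _]]/(map vtx [:: 16; 15; 8]) uniq_vtx.
by rewrite !(reflection_conjJ X_trans Y_trans) !tperm_vtx.
Qed.

Lemma translations_commute p q r s : uniq [:: p; q; r; s] -> commute (X p q) (Y r s).
Proof.
move=> u_pqrs; apply: (commute_translations_of_reflections X_trans Y_trans u_pqrs).
have u0 : uniq (map vtx [:: 7; 15; 3; 10]) by rewrite uniq_vtx.
have [g [<- <- <- <-]] := perm_map_exists u0 u_pqrs erefl.
rewrite -!(reflectionJ X_trans) -(reflectionJ Y_trans); apply: commute_conj.
by rewrite X13 Y8; apply: commute_edge_gen.
Qed.

Lemma translation_product_commute p q r s : uniq [:: p; q; r; s] -> commute (X q p * X r s) (Y q r).
Proof.
move=> u_pqrs; apply: (commute_translation_product X_trans Y_trans u_pqrs).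
have u0 : uniq (map vtx [:: 3; 8; 12; 15]) by rewrite uniq_vtx.
have [g [<- <- <- <-]] := perm_map_exists u0 u_pqrs erefl.
by rewrite -!(reflection_conjJ X_trans Y_trans) -edge15_hexagon4 -edge15_hexagon7.
Qed.

End WithTranslations.
End WithPathMorphism.

Lemma model_retraction_exists : exists2 f : pheis int 18 -> G,
  {in balanced &, {morph f : m m' / m * m'}} & forall j, f (sgen j) = u j.
Proof.
have [rho rho_path_edges] := path_morphism_exists.
have [X X_trans X13] := translations13_exist rho_path_edges.
have [Y Y_trans Y8] := translations8_exist rho_path_edges.
have [f [fM f_sym f_x f_y]] := balanced_morphism_exists (n := 18) isT X_trans Y_trans
  (translations_commute X_trans Y_trans X13 Y8)
  (translation_product_commute rho_path_edges X_trans Y_trans X13 Y8).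
have f_known : {in [:: 13; 8], forall k, f (sgen (edg k)) = U k}.
  move=> k; rewrite !inE => /orP[/eqP ->|/eqP ->]; rewrite sgen_edg //.
    by rewrite pair_col_x f_x X13.
  by rewrite pair_col_y f_y Y8.
have chain : hexagon_chain ([:: 13; 8] ++ path_edges) [:: 10; 17; 7; 23; 4; 24; 26; 15].
  by vm_compute.
exists f => // j; have [k kl ->] := edgP j; apply: (sgen_chain rho_path_edges fM f_sym chain) => //.
by move: k kl; apply/allP; vm_compute.
Qed.

End Reconstruction.

Lemma balanced_sgen_ind (P : pheis int 18 -> Prop) :
  (forall m m', P m -> P m' -> P (m * m')) -> (forall m, P m -> P m^-1) ->
  (forall j, P (sgen j)) -> forall m, m \in balanced -> P m.
Proof.
move=> PM PV P_sgen; have P_sym s : P (sym_in s).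
  move: s; apply: path_edges_perm_ind => [|s t Ps Pt|k kin].
  - by rewrite gmulf1 -(mulVg (sgen (edg 1))); apply: PM => //; apply: PV.
  - by rewrite gmulfM; apply: PM.
  - by rewrite -sgen_path_edge.
have P_refl a b p q w : a \in vertices -> b \in vertices -> a != b -> p != q ->
    P (refl (vtx a) (vtx b) w) -> P (refl p q w).
  move=> av bv ab pq P_ab; have ab_uniq : uniq (map vtx [:: a; b]).
    by rewrite uniq_vtx /= ?av ?bv // inE ab.
  have [|g [<- <-]] := perm_map_exists ab_uniq (_ : uniq [:: p; q]) erefl.
    by rewrite /= inE pq.
  by rewrite -reflJ conjgE; apply: (PM); [apply: PV | apply: PM].
apply: balanced_ind => // k p q pq.
have /orP[/eqP->|/eqP->] : (k == 0%R) || (k == 1%R) by case: k => [[|[]]].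
- by apply: (P_refl 7 15)%N => //; have := P_sgen (edg 13); rewrite sgen_edg // pair_col_x.
- by apply: (P_refl 3 10)%N => //; have := P_sgen (edg 8); rewrite sgen_edg // pair_col_y.
Qed.

(** * The group [C] *)

Section PresentationC.
Variables (C : agroup) (u : 'I_27 -> C).
Hypothesis C_pres : presentsC u.

Lemma presentsC_morphism (K : groupType) v : @CRel (agroup_of K) v ->
  exists f : {gmorphism C -> K}, forall j, f (u j) = v j.
Proof. by case: C_pres => _ univ /univ[f [[fM fu] _]]; exists (@gmorphism_of C K f fM). Qed.

Lemma presentsC_ext (K : groupType) (f g : {gmorphism C -> K}) :
  (forall j, f (u j) = g (u j)) -> f =1 g.
Proof.
case: C_pres => u_rel univ fg c.
have f_rel : @CRel (agroup_of K) (fun j => f (u j)).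
  by apply: (@CRel_morph_in C K predT f) u_rel => // a b _ _; apply: gmulfM.
have [h [_ h_uniq]] := univ _ _ f_rel.
have hf : h = f by apply: h_uniq; split=> //; exact: (@gmulfM _ _ f).
have hg : h = g by apply: h_uniq; split=> //; exact: (@gmulfM _ _ g).
by rewrite -[LHS](congr1 (@^~ c) hf) hg.
Qed.

Lemma presentsC_balanced (f : {gmorphism C -> pheis int 18}) :
  (forall j, f (u j) \in balanced) -> forall c, f c \in balanced.
Proof.
move=> fu c; pose total c : ZmodGroup 'cV[int]_2 := vsum (hvec (pheisen (f c))).
have totalM : {morph total : a b / a * b}.
  by move=> a b; rewrite /total gmulfM /= vsumD vsum_perm.
have total1 : gmorphism_of totalM =1 (@one_fun C (ZmodGroup 'cV[int]_2)).
  by apply: presentsC_ext => j; have := fu j; rewrite inE => /eqP.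
by rewrite inE; apply/eqP/total1.
Qed.

Lemma presentsC_iso : exists f : {gmorphism C -> pheis int 18},
  [/\ forall j, f (u j) = sgen j, injective f &
      forall m, m \in balanced <-> exists c, f c = m].
Proof.
have [f fu] := presentsC_morphism sgen_CRel.
have f_balanced : forall c, f c \in balanced.
  by apply: presentsC_balanced => j; rewrite fu balanced_sgen.
exists f; split=> // [|m].
  have [r rM ru] := model_retraction_exists C_pres.1.
  have rfM : {morph r \o f : a b / a * b} by move=> a b; rewrite /= gmulfM rM ?f_balanced.
  apply: (can_inj (g := r)).
  by apply: (presentsC_ext (f := gmorphism_of rfM) (g := idfun)) => j; rewrite /= fu ru.
split=> [|[c <- //]].
move: m; apply: balanced_sgen_ind => [_ _ [a <-] [b <-]|_ [a <-]|j].
- by exists (a * b); rewrite gmulfM.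
- by exists a^-1; rewrite gmulfV.
- by exists (u j).
Qed.

End PresentationC.

(** * The group [H] *)

Lemma heis_HRel :
  @HRel (agroup_of (heis int 18)) heis_x heis_y heis_z.
Proof.
split=> [i j ij|i|].
- by split; rewrite (@gcommE (agroup_of (heis int 18))) ?heis_xx ?heis_yy ?heis_xy ?(negPf ij).
- by rewrite (@gcommE (agroup_of (heis int 18))) heis_xy eqxx.
- exact: heis_central.
Qed.

Lemma HRel_heis_nfM (H : agroup) (x y : 'I_18 -> H) (z : H) : HRel x y z ->
  {morph (fun h : heis int 18 => heis_nf x y z (hvec h) (hcen h) : H) : h h' / h * h'}.
Proof.
move=> [xy_comm xy_z z_central] h h'.
have commE (a b : H) : gcomm a b = gone -> commute a b.
  by rewrite gcommE => ab; apply/commgP/eqP.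
have XX i j : commute (x i) (x j).
  by have [->//|/xy_comm[/commE]] := eqVneq i j.
have YY i j : commute (y i) (y j).
  by have [->//|/xy_comm[_ /commE]] := eqVneq i j.
have XY i j : x i ^ y j = x i * expgz z ((1%:M : 'M[int]_18) i j)%R.
  rewrite mxE conjg_commg -gcommE; have [<-|/xy_comm[_ _ ->]] := eqVneq i j.
    by rewrite xy_z.
  by [].
rewrite (heis_nfM XX YY _ _ XY) => [|i|i]; try exact: z_central.
congr (heis_nf _ _ _ _ (_ - _)%R).
by rewrite /bform mulmx1 /hform !mxE; apply: eq_bigr => i _; rewrite !mxE.
Qed.

Section PresentationH.
Variables (H : agroup) (x y : 'I_18 -> H) (z : H).
Hypothesis H_pres : presentsH x y z.

Lemma presentsH_morphism (K : groupType) x' y' z' : @HRel (agroup_of K) x' y' z' ->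
  exists f : {gmorphism H -> K}, [/\ forall i, f (x i) = x' i, forall i, f (y i) = y' i & f z = z'].
Proof. by case: H_pres => _ univ /univ[f [[fM ? ? ?] _]]; exists (@gmorphism_of H K f fM). Qed.

Lemma presentsH_ext (K : groupType) (f g : {gmorphism H -> K}) :
  (forall a, commute (f z) a) ->
  (forall i, f (x i) = g (x i)) -> (forall i, f (y i) = g (y i)) -> f =1 g.
Proof.
case: H_pres => [[xy_comm xy_z z_central] univ] fz_central fgx fgy h.
have fz : f z = g z by rewrite -(xy_z ord0) gcommE !gmulfR fgx fgy.
have f_rel : @HRel (agroup_of K) (f \o x) (f \o y) (f z).
  have fR (a b : H) : @gcomm (agroup_of K) (f a) (f b) = f (gcomm a b).
    by rewrite (@gcommE (agroup_of K)) gcommE gmulfR.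
  split=> [i j /xy_comm[xx yy xy]|i|//]; last by rewrite fR xy_z.
  by split; rewrite fR ?xx ?yy ?xy; exact: (@gmulf1 _ _ f).
have [k [_ k_uniq]] := univ _ _ _ _ f_rel.
have kf : k = f by apply: k_uniq; split=> //; exact: (@gmulfM _ _ f).
have kg : k = g.
  by apply: k_uniq; split=> [|i|i|] /=; rewrite ?fgx ?fgy ?fz //; exact: (@gmulfM _ _ g).
by rewrite -[LHS](congr1 (@^~ h) kf) kg.
Qed.

Lemma presentsH_iso : exists F : {gmorphism H -> heis int 18},
  [/\ forall i, F (x i) = heis_x i, forall i, F (y i) = heis_y i, F z = heis_z & bijective F].
Proof.
have [F [Fx Fy Fz]] := presentsH_morphism heis_HRel.
pose N (h : heis int 18) : H := heis_nf x y z (hvec h) (hcen h).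
have [[_ _ z_central] _] := H_pres.
exists F; split=> //; exists N => h; last first.
  by case: h => v c; rewrite /N gmulf_heis_nf Fz -[RHS]heis_nf_heis; apply: eq_heis_nf.
have NFM : {morph N \o F : a b / a * b}.
  by move=> a b; rewrite /= gmulfM /N HRel_heis_nfM //; case: H_pres.
have Nz : N heis_z = z by rewrite /N heis_nf0.
apply: (presentsH_ext (f := gmorphism_of NFM) (g := idfun)) => [a|i|i] /=.
- by rewrite Fz Nz; apply: z_central.
- by rewrite Fx /N heis_nf_x.
- by rewrite Fy /N heis_nf_y.
Qed.

End PresentationH.

Lemma presentsC_pperm (C : agroup) (u : 'I_27 -> C) (psi : C -> PermGroup)
    (f : {gmorphism C -> pheis int 18}) :
  presentsC u -> ghom psi -> (forall j, psi (u j) = tperm (ep1 j) (ep2 j)) ->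
  (forall j, f (u j) = sgen j) -> forall c, psi c = pperm (f c).
Proof.
move=> C_pres psiM psi_u fu; pose K : groupType := {perm 'I_18}.
have pfM : {morph (fun c => pperm (f c) : K) : a b / a * b} by move=> a b; rewrite gmulfM.
apply: (presentsC_ext C_pres (f := @gmorphism_of C K psi psiM) (g := gmorphism_of pfM)).
by move=> j; rewrite /= psi_u fu.
Qed.

Section HeisenbergModel.
Variables (H : agroup) (x y : 'I_18 -> H) (z : H) (F : {gmorphism H -> heis int 18}).
Hypothesis H_pres : presentsH x y z.
Hypothesis F_x : forall i, F (x i) = heis_x i.
Hypothesis F_y : forall i, F (y i) = heis_y i.
Hypothesis F_z : F z = heis_z.

Lemma presentsH_vsum (ab : H -> Z2) : ghom ab ->
  (forall i, ab (x i) = xZ) -> (forall i, ab (y i) = yZ) ->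
  forall h, ab h = 0%R <-> vsum (hvec (F h)) = 0%R.
Proof.
move=> abM ab_x ab_y h; pose total h : Z2 := (vsum (hvec (F h)))^T%R.
have totalM : {morph total : a b / a * b}.
  by move=> a b; rewrite /total gmulfM /= vsumD linearD.
have -> : ab h = total h.
  apply: (presentsH_ext H_pres (f := gmorphism_of abM) (g := gmorphism_of totalM)).
  - by move=> a; apply: addrC.
  - by move=> i; rewrite /= /total F_x ab_x vsum_delta trmx_delta.
  - move=> i; rewrite /= /total F_y ab_y vsum_delta trmx_delta /yZ.
    by congr (delta_mx _ _); apply: val_inj; rewrite /= inordK.
by rewrite /total; split=> [/(canRL (@trmxK _ _ _)) ->|->]; rewrite linear0.
Qed.

Lemma presentsH_act (act : H -> H) (s : 'S_18) : ghom act ->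
  (forall i, act (x i) = x (s i)) -> (forall i, act (y i) = y (s i)) -> act z = z ->
  forall h, F (act h) = heis_perm s (F h).
Proof.
move=> actM act_x act_y act_z.
have FaM : {morph F \o act : a b / a * b} by move=> a b; rewrite /= [act _]actM [LHS]gmulfM.
have pFM : {morph (heis_perm s \o F) : a b / a * b}.
  by move=> a b; rewrite /= gmulfM heis_permM.
apply: (presentsH_ext H_pres (f := gmorphism_of FaM) (g := gmorphism_of pFM)) => [h|i|i] /=.
- by rewrite act_z F_z; apply: heis_central.
- by rewrite act_x !F_x /heis_perm /= delta_perm.
- by rewrite act_y !F_y /heis_perm /= delta_perm.
Qed.

End HeisenbergModel.

(** * Comparison with the model *)

Section Comparison.
Variables (C H : agroup) (u : 'I_27 -> C).
Variables (psi : C -> PermGroup) (ab : H -> Z2) (act : {perm 'I_18} -> H -> H).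
Variables (f : {gmorphism C -> pheis int 18}) (F : {gmorphism H -> heis int 18}).
Hypothesis f_u : forall j, f (u j) = sgen j.
Hypothesis f_inj : injective f.
Hypothesis f_onto : forall m, m \in balanced <-> exists c, f c = m.
Hypothesis F_bij : bijective F.
Hypothesis psi_f : forall c, psi c = pperm (f c).
Hypothesis ab_F : forall h, ab h = 0%R <-> vsum (hvec (F h)) = 0%R.
Hypothesis act_F : forall s h, F (act s h) = heis_perm s (F h).

Lemma balanced_lift_exists s h : vsum (hvec h) = 0%R -> exists c, f c = PHeis s h.
Proof. by move=> h0; apply/f_onto; rewrite inE h0. Qed.

Lemma vsum_model c : vsum (hvec (pheisen (f c))) = 0%R.
Proof. by apply/eqP; have /f_onto := ex_intro (fun d => f d = f c) c erefl. Qed.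

Lemma psi_morph : {morph psi : a b / a * b >-> (a * b : 'S_18)}.
Proof. by move=> a b; rewrite !psi_f gmulfM. Qed.

Lemma psi_surjective s : exists c, psi c = s.
Proof.
have [|c f_c] := @balanced_lift_exists s 1; first exact: mul0mx.
by exists c; rewrite psi_f f_c.
Qed.

Definition tree_subgroup : C -> Prop := gen_sub (fun c => exists2 j, j \in T0 & c = u j).

Lemma model_tree_subgroup a : tree_subgroup a -> f a = gauged T0_potential (psi a).
Proof.
elim=> [|_ [j jT0 ->]|b c _ fb _ fc|b _ fb].
- by rewrite psi_f [f gone]gmulf1 gmulf1.
- by rewrite psi_f f_u -sgen_T0 // pperm_gauged.
- by rewrite [f _]gmulfM [psi _]psi_morph gmulfM fb fc.
- by rewrite [f _]gmulfV fb -gmulfV !psi_f [f (ginv b)]gmulfV.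
Qed.

Lemma tree_subgroup_inj a b : tree_subgroup a -> tree_subgroup b -> psi a = psi b -> a = b.
Proof. by move=> La Lb ab_eq; apply: f_inj; rewrite !model_tree_subgroup // ab_eq. Qed.

Lemma tree_subgroup_onto s : exists a, tree_subgroup a /\ psi a = s.
Proof.
move: s; apply: T0_perm_ind => [|s t [a [La <-]] [b [Lb <-]]|j jT0].
- by exists gone; split; [apply: gen_one | rewrite psi_f [f _]gmulf1].
- by exists (a ** b); split; [apply: gen_mul | apply: psi_morph].
- exists (u j); split; first by apply: gen_in; exists j.
  by rewrite psi_f f_u.
Qed.

Lemma tree_subgroup_factorization c : exists! kl : C * C,
  [/\ gker psi kl.1, tree_subgroup kl.2 & c = kl.1 ** kl.2].
Proof.
have [l [Ll psi_l]] := tree_subgroup_onto (psi c); exists (c * l^-1, l); split=> [|[k l'] /=].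
  split=> //=; last by rewrite [RHS]mulgVK.
  by rewrite /gker psi_f gmulfM gmulfV /= -!psi_f psi_l mulgV.
case=> k_ker Ll' c_def; have l_eq : l = l'.
  apply: tree_subgroup_inj => //; rewrite psi_l c_def [LHS]psi_morph.
  by rewrite k_ker mul1g.
by rewrite l_eq c_def [_ * _]mulgK.
Qed.

Lemma crossed_morphism_exists : exists phi : C -> H, forall c, F (phi c) = pheisen (f c).
Proof. by have [N _ NK] := F_bij; exists (fun c => N (pheisen (f c))) => c; rewrite NK. Qed.

Section CrossedMorphism.
Variable phi : C -> H.
Hypothesis phi_f : forall c, F (phi c) = pheisen (f c).

Lemma crossed_morphism_ker c : ab (phi c) = 0%R.
Proof. by apply/ab_F; rewrite phi_f vsum_model. Qed.

Lemma crossed_morphismM c d : phi (c ** d) = act (psi d) (phi c) ** phi d.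
Proof.
apply: (bij_inj F_bij); rewrite phi_f [f _]gmulfM [RHS]gmulfM act_F !phi_f psi_f.
by [].
Qed.

Lemma crossed_morphism_bijective (s : PermGroup) k : ab k = 0%R ->
  exists! c, psi c = s /\ phi c = k.
Proof.
move=> /ab_F k0; have [c f_c] := balanced_lift_exists s k0; exists c; split=> [|d [psi_d phi_d]].
  by split; [rewrite psi_f f_c | apply: (bij_inj F_bij); rewrite phi_f f_c].
apply: f_inj; rewrite f_c; case: (f d) (psi_f d) (phi_f d) => s' h' /= <- <-.
by rewrite psi_d phi_d.
Qed.

Lemma crossed_morphism_iso_on : iso_on phi (gker psi) (gker ab).
Proof.
have act1 h : act 1 h = h by apply: (bij_inj F_bij); rewrite act_F heis_perm1.
split=> [a b _ b_ker|a _|a b a_ker b_ker ab_eq|k /crossed_morphism_bijective k_lift].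
- by rewrite crossed_morphismM b_ker act1.
- exact: crossed_morphism_ker.
- have [c [_ c_uniq]] := crossed_morphism_bijective gone (crossed_morphism_ker b).
  by rewrite -(c_uniq a) // (c_uniq b).
- by have [c [[c_ker <-] _]] := k_lift gone; exists c.
Qed.

End CrossedMorphism.

Definition kernel_coordinates (c : C) : Z34 :=
  mxvec (col' ord0 (hvec (pheisen (f c)))).

Lemma kernel_coordinatesM a b : gker psi b ->
  kernel_coordinates (a ** b) = kernel_coordinates a ** kernel_coordinates b.
Proof.
rewrite /gker psi_f /kernel_coordinates [f (a ** b)]gmulfM /= => ->.
by rewrite perm_mx1 mulmx1 !linearD.
Qed.

Lemma kernel_coordinates_onto v : exists2 a, gker psi a & kernel_coordinates a = v.
Proof.
pose w := (vec_mx (v : 'rV_(2 * 17)) *m row' ord0 (dmx (ord0 : 'I_18)))%R.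
have [|a f_a] := balanced_lift_exists 1 (h := Heis w 0%R); first exact: vsum_mulmx_dmx.
exists a; first by rewrite /gker psi_f f_a.
by rewrite /kernel_coordinates f_a mulmx_dmx_col' vec_mxK.
Qed.

Lemma heis_z_lift_exists : exists zC : C, f zC = heis_in heis_z.
Proof. by have [|zC f_zC] := @balanced_lift_exists 1 heis_z; [exact: mul0mx | exists zC]. Qed.

Section Center.
Variable zC : C.
Hypothesis f_zC : f zC = heis_in heis_z.

Lemma model_gpow m : f (gpow zC m) = heis_in (Heis 0%R m).
Proof. by rewrite gpowE gmulf_expgz f_zC heis_center_expgz gmulf_expgz. Qed.

Lemma gpow_heis_z_eq1 m : gpow zC m = gone -> m = 0%R.
Proof. by move=> /(congr1 f); rewrite model_gpow [f gone]gmulf1 => -[]. Qed.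

Lemma central_gpow c : central c <-> exists m, c = gpow zC m.
Proof.
split=> [c_central|[m ->] d]; last first.
  by apply: f_inj; rewrite [LHS]gmulfM [RHS]gmulfM model_gpow; apply: commute_heis_center.
have [||m f_c] := commute_sym_in_balanced (m := f c) (isT : 2 < 18)%N.
- by rewrite inE vsum_model.
- move=> s; have [|d f_d] := balanced_lift_exists s (h := 1); first exact: mul0mx.
  by rewrite /commute -[sym_in s]f_d -!gmulfM [c * d]c_central.
by exists m; apply: f_inj; rewrite model_gpow.
Qed.

Lemma kernel_coordinates_eq0 a : gker psi a ->
  kernel_coordinates a = gone <-> exists m, a = gpow zC m.
Proof.
rewrite /gker psi_f => a_ker; split=> [a0|[m ->]]; last first.
  by rewrite /kernel_coordinates model_gpow !linear0.
exists (hcen (pheisen (f a))); apply: f_inj; rewrite model_gpow.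
have := vsum_model a; move: a_ker a0; rewrite /kernel_coordinates.
case: (f a) => s [v m] /= -> a0 v0; congr (PHeis _ (Heis _ _)).
rewrite -(col'_mulmx_dmx ord0 v0) -[col' _ _]mxvecK [mxvec _]a0.
by rewrite linear0 mul0mx.
Qed.

End Center.
End Comparison.

Theorem theorem1p1
  (C : agroup) (u : 'I_27 -> C) (HC : presentsC u)
  (psi : C -> PermGroup) (psi_hom : ghom psi)
  (psi_u : forall j, psi (u j) = tperm (ep1 j) (ep2 j))
  (H : agroup) (x y : 'I_18 -> H) (z : H) (HH : presentsH x y z)
  (ab : H -> Z2) (ab_hom : ghom ab)
  (ab_x : forall i, ab (x i) = xZ) (ab_y : forall i, ab (y i) = yZ)
  (ab_z : ab z = 0%R)
  (act : {perm 'I_18} -> H -> H) (act_hom : forall s, ghom (act s))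
  (act_x : forall s i, act s (x i) = x (s i))
  (act_y : forall s i, act s (y i) = y (s i))
  (act_z : forall s, act s z = z) :
  (* (i) *)
  ((forall s : PermGroup, exists c, psi c = s) /\
   (let L := gen_sub (fun c : C => exists2 j, j \in T0 & c = u j) in
    [/\ (forall a b, L a -> L b -> psi a = psi b -> a = b),
        (forall s : PermGroup, exists a, L a /\ psi a = s) &
        (forall c : C, exists! kl : C * C,
            [/\ gker psi kl.1, L kl.2 & c = kl.1 ** kl.2])])) /\
  (* (ii) *)
  (exists f : C -> H, iso_on f (gker psi) (gker ab)) /\
  (exists phi : C -> H,
     [/\ (forall c, ab (phi c) = 0%R),
         (forall c d, phi (c ** d) = act (psi d) (phi c) ** phi d),
         (forall (s : PermGroup) (k : H), ab k = 0%R ->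
             exists! c, psi c = s /\ phi c = k) &
  (* (iii) *)
         (exists zC : C,
            [/\ psi zC = gone, phi zC = z,
                (forall n, gpow zC n = gone -> n = 0%R),
                (forall c, central c <-> exists n, c = gpow zC n) &
                (exists q : C -> Z34,
                   [/\ (forall a b, gker psi a -> gker psi b -> q (a ** b) = q a ** q b),
                       (forall v : Z34, exists2 a, gker psi a & q a = v) &
                       (forall a, gker psi a -> (q a = gone <-> exists n, a = gpow zC n))])])]).
Proof.
have [f [f_u f_inj f_onto]] := presentsC_iso HC.
have [F [F_x F_y F_z F_bij]] := presentsH_iso HH.
have psi_f := presentsC_pperm HC psi_hom psi_u f_u.
have ab_F := presentsH_vsum HH F_x F_y ab_hom ab_x ab_y.
have act_F s := presentsH_act HH F_x F_y F_z (act_hom s) (act_x s) (act_y s) (act_z s).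
have [phi phi_f] := crossed_morphism_exists f F_bij.
have [zC f_zC] := heis_z_lift_exists f_onto.
split; [split; last split | split; last (exists phi; split)].
- exact: (psi_surjective f_onto psi_f).
- exact: (tree_subgroup_inj f_u f_inj psi_f).
- exact: (tree_subgroup_onto f_u psi_f).
- exact: (tree_subgroup_factorization f_u f_inj psi_f).
- by exists phi; exact: (crossed_morphism_iso_on f_inj f_onto F_bij psi_f ab_F act_F phi_f).
- exact: (crossed_morphism_ker f_onto ab_F phi_f).
- exact: (crossed_morphismM F_bij psi_f act_F phi_f).
- exact: (crossed_morphism_bijective f_inj f_onto F_bij psi_f ab_F phi_f).
exists zC; split; last (exists (kernel_coordinates f); split).
- by rewrite psi_f f_zC.
- by apply: (bij_inj F_bij); rewrite phi_f f_zC F_z.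
- exact: (gpow_heis_z_eq1 f_zC).
- exact: (central_gpow f_inj f_onto f_zC).
- by move=> a b _; apply: (kernel_coordinatesM psi_f).
- exact: (kernel_coordinates_onto f_onto psi_f).
- exact: (kernel_coordinates_eq0 f_inj f_onto psi_f f_zC).
Qed.
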